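(* Let $n\ge2$ be an integer. For any $c>0$, the peaked function $$\varphi_c(t,x)=a\,e^{-|x-ct|},\qquad\text{where } c=\Big(1-\sum_{k=1}^n\frac{(-1)^{k+1}}{2k+1}\binom{n}{k}\Big)a^{2n},$$ is a global weak solution of the generalized modified Camassa-Holm equation (with initial datum $\varphi_c(0,x)=a e^{-|x|}$), in the sense of weak solution given in the context.
   Context: The generalized modified Camassa-Holm (gmCH) equation is $y_t+\big((u^2-u_x^2)^n y\big)_x=0$, $y=u-u_{xx}$, $t\ge 0$, $x\in\mathbb{R}$, with $n\ge 2$ an integer. Let $p(x)=\frac12 e^{-|x|}$, so that $(1-\partial_x^2)^{-1}f=p*f$, where $*$ is convolution in $x$. Definition of weak solution: let $u_0\in W^{1,2n+1}(\mathbb{R})$ be given. If $u\in L^\infty_{loc}([0,T);W^{1,2n+1}_{loc}(\mathbb{R}))$ satisfies $$\int_0^T\!\!\int_{\mathbb{R}}\Big[u\phi_t+\tfrac{1}{2n+1}u^{2n+1}\phi_x+\Big(\sum_{k=1}^n\tfrac{(-1)^{k+1}}{2k+1}\tbinom{n}{k}u^{2n-2k}u_x^{2k+1}\Big)\phi$$ $$+\,p*\Big(\tfrac{2n}{2n+1}u^{2n+1}+\sum_{k=1}^n\tfrac{(-1)^{k-1}}{2k-1}\tbinom{n}{k}u^{2n-2k+1}u_x^{2k}\Big)\cdot\partial_x\phi$$ $$-\,p*\Big(\sum_{k=1}^n\tfrac{(-1)^{k+1}}{2k+1}\tbinom{n}{k}u^{2n-2k}u_x^{2k+1}\Big)\cdot\phi\Big]dx\,dt+\int_{\mathbb{R}}u_0(x)\phi(0,x)\,dx=0$$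 for every $\phi\in C_c^\infty([0,T)\times\mathbb{R})$, then $u$ is called a weak solution of the gmCH equation (with initial datum $u_0$). If $u$ is a weak solution on $[0,T)$ for every $T>0$, it is called a global weak solution. *)

(* Defs.v *)
From HB Require Import structures.
From mathcomp Require Import all_boot all_order all_algebra.
From mathcomp Require Import all_classical all_reals all_analysis.
From mathcomp Require Import ess_sup_inf.

Set Implicit Arguments.
Unset Strict Implicit.
Unset Printing Implicit Defensive.

Import Order.TTheory GRing.Theory Num.Theory.
Import numFieldNormedType.Exports.

Local Open Scope classical_set_scope.
Local Open Scope ring_scope.

(* C^k through directional derivatives along all vectors; this is the usual
   notion when V is finite-dimensional, and it is only used for V = R and
   V = R * R. *)
Fixpoint of_class_C (R : realType) (V : normedModType R) (k : nat)
    (f : V -> R^o) : Prop :=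
  continuous f /\
  (if k is k'.+1 then
     forall v : V, (forall x, derivable f x v) /\ of_class_C k' ('D_v f)
   else True).

Definition smooth (R : realType) (V : normedModType R) (f : V -> R^o) : Prop :=
  forall k, of_class_C k f.

Section Sobolev.
Context {R : realType}.
Local Notation mu := (@lebesgue_measure R).

Definition test_function (psi : R -> R) : Prop :=
  @smooth R R^o psi /\ compact (closure [set x | psi x != 0]).

Definition weak_derivative (f g : R -> R) : Prop :=
  [/\ locally_integrable [set: R] f, locally_integrable [set: R] g &
    forall psi : R -> R, test_function psi ->
      \int[mu]_x (f x * derive1 psi x) = - \int[mu]_x (g x * psi x)].

Definition W1 (p : R) (f : R -> R) : Prop :=
  exists g : R -> R,
    [/\ f \in Lfun mu p%:E, g \in Lfun mu p%:E & weak_derivative f g].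

(* the W^{1,p} norm on K of a function f with weak derivative g *)
Definition W1norm (p : R) (K : set R) (f g : R -> R) : \bar R :=
  ('N[mu]_(p%:E) [EFin \o (f \_ K)] + 'N[mu]_(p%:E) [EFin \o (g \_ K)])%E.

Definition strip (T : R) : set (measurableTypeR R * measurableTypeR R) :=
  [set z | 0 <= z.1 < T].

(* u belongs to L^oo_loc([0, T); W^{1,p}_loc(R)) and ux(t) is the weak
   derivative of u(t) for almost every t *)
Definition Linfloc_W1loc (T p : R) (u ux : R -> R -> R) : Prop :=
  [/\ measurable_fun (strip T)
        (fun z : measurableTypeR R * measurableTypeR R => u z.1 z.2),
      measurable_fun (strip T)
        (fun z : measurableTypeR R * measurableTypeR R => ux z.1 z.2),
      {ae mu, forall t, 0 <= t < T -> weak_derivative (u t) (ux t)} &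
      forall (T' : R) (K : set R), 0 <= T' < T -> compact K ->
        (ess_sup mu
           ((fun t => W1norm p K (u t) (ux t)) \_ `[0%R, T']) < +oo)%E].

End Sobolev.

Section Convolution.
Context {R : realType}.
Local Notation mu := (@lebesgue_measure R).

Definition convolvable (f g : R -> R) (x : R) : Prop :=
  mu.-integrable [set: R] (fun y => (f (x - y) * g y)%:E).

Definition convolution (f g : R -> R) (x : R) : R :=
  \int[mu]_y (f (x - y) * g y).

End Convolution.

Section gmCH.
Context {R : realType}.
Local Notation mu := (@lebesgue_measure R).

(* the kernel of (1 - d^2/dx^2)^-1 *)
Definition green (x : R) : R := 2^-1 * expR (- `|x|).

Definition sourceA (n : nat) (u ux : R) : R :=
  (2 * n)%:R / (2 * n + 1)%:R * u ^+ (2 * n + 1) +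
  \sum_(1 <= k < n.+1)
    (-1) ^+ (k - 1) / (2 * k - 1)%:R * 'C(n, k)%:R *
      u ^+ (2 * n - 2 * k + 1) * ux ^+ (2 * k).

Definition sourceB (n : nat) (u ux : R) : R :=
  \sum_(1 <= k < n.+1)
    (-1) ^+ (k + 1) / (2 * k + 1)%:R * 'C(n, k)%:R *
      u ^+ (2 * n - 2 * k) * ux ^+ (2 * k + 1).

(* Elements of C_c^oo([0, T) x R) are represented by smooth functions on R^2
   of which only the values on [0, T) x R are relevant: the support is taken
   relative to the strip, so phi need not vanish at t = 0. *)
Definition spacetime_test_function (T : R) (phi : R * R -> R) : Prop :=
  let S : set (R * R) := [set z | 0 <= z.1 < T] in
  let supp := closure [set z | S z /\ phi z != 0] in
  [/\ @smooth R (R^o * R^o)%type phi, compact supp & supp `<=` S].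

Definition dt (phi : R * R -> R) (t x : R) : R :=
  'D_(1, 0) (phi : R^o * R^o -> R^o) (t, x).
Definition dx (phi : R * R -> R) (t x : R) : R :=
  'D_(0, 1) (phi : R^o * R^o -> R^o) (t, x).

Definition weak_integrand (n : nat) (u ux : R -> R -> R) (phi : R * R -> R)
    (t x : R) : R :=
  let A y := sourceA n (u t y) (ux t y) in
  let B y := sourceB n (u t y) (ux t y) in
  u t x * dt phi t x
  + (2 * n + 1)%:R^-1 * u t x ^+ (2 * n + 1) * dx phi t x
  + B x * phi (t, x)
  + convolution green A x * dx phi t x
  - convolution green B x * phi (t, x).

(* The convolutions and the space-time integral are required to converge
   absolutely, since the library integral is a total function with a
   conventional value on non-integrable functions. *)
Definition weak_solution (n : nat) (T : R) (u0 : R -> R) (u : R -> R -> R) :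
    Prop :=
  W1 (2 * n + 1)%:R u0 /\
  exists ux : R -> R -> R,
    [/\ Linfloc_W1loc T (2 * n + 1)%:R u ux,
        {ae (mu \x mu)%E, forall z, strip T z ->
           convolvable green (fun y => sourceA n (u z.1 y) (ux z.1 y)) z.2 /\
           convolvable green (fun y => sourceB n (u z.1 y) (ux z.1 y)) z.2} &
        forall phi : R * R -> R, spacetime_test_function T phi ->
          (mu \x mu)%E.-integrable (strip T)
            (fun z => (weak_integrand n u ux phi z.1 z.2)%:E) /\
          \int[mu]_(t in `[0, T[) (\int[mu]_x weak_integrand n u ux phi t x)
          + \int[mu]_x (u0 x * phi (0, x)) = 0].

Definition global_weak_solution (n : nat) (u0 : R -> R) (u : R -> R -> R) :
    Prop :=
  forall T : R, 0 < T -> weak_solution n T u0 u.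

Definition peakon (a c t x : R) : R := a * expR (- `|x - c * t|).

Definition speed (n : nat) (a : R) : R :=
  (1 - \sum_(1 <= k < n.+1) (-1) ^+ (k + 1) / (2 * k + 1)%:R * 'C(n, k)%:R)
    * a ^+ (2 * n).

End gmCH.

(* Main.v *)
Require Import Defs.
From mathcomp Require Import all_boot all_order all_algebra.
From mathcomp Require Import all_classical all_reals all_analysis.
From mathcomp Require Import ess_sup_inf measurable_realfun.
From mathcomp Require Import measurable_fun_approximation ring lra zify.
Import Order.TTheory GRing.Theory Num.Theory.
Import numFieldNormedType.Exports.

Set Implicit Arguments.
Unset Strict Implicit.
Unset Printing Implicit Defensive.

Local Open Scope classical_set_scope.
Local Open Scope ring_scope.

(* Write m = 2n + 1, E = e^{-|x - ct|} and s for the sign of x - ct, so that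
   u = aE and u_x = -s u.  Since s^2 = 1, the two source terms are A a^m E^m and
   -B s a^m E^m with constants A, B satisfying m A + B = (m^2 - 1)(1 - B), and
     p * E^m = (m E - E^m) / (m^2 - 1),
     p * (s E^m) = s (E - E^m) / (m^2 - 1).
   Integration by parts in x, across the crest, removes all powers E^m and
   reduces the weak form at time t to the integral of a E phi_t + a c s E phi,
   because a c = (1 - B) a^m.  By Fubini this is integrated first in t, where
   E_t = c s E, leaving exactly minus the initial term. *)

(** The constants are Wallis integrals. With I_n the integral of (1 - r^2)^n over [0, 1],
    [1 - coefB n] is I_n, and [coefA n] is the integral of (1 - (1 - r^2)^n) / r^2, so an
    integration by parts gives 1 + [coefA n] = 2n I_{n-1} = m I_n for n >= 1. This is the relation
    between A and B in disguise; the proof derives it from binomial sums, without these integrals.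
    The relation does double duty. The speed enters only the coefficient of s E phi, so nothing
    could be tuned to make the s E^m phi terms match the E^m phi_x terms; the same identity settles
    both balances. The order of integration matters as well: the E^m terms vanish at each fixed
    time, whereas the remaining E terms form a t-derivative and are integrated at each fixed
    position. *)

(** * Binomial identities for the coefficients, and the source terms on a unit slope *)

Section Coefficients.
Context {R : realType}.
Implicit Types (n : nat) (u s : R).

Definition coefB n : R :=
  \sum_(1 <= k < n.+1) (-1) ^+ (k + 1) / (2 * k + 1)%:R * 'C(n, k)%:R.

Definition coefA n : R :=
  \sum_(1 <= k < n.+1) (-1) ^+ (k - 1) / (2 * k - 1)%:R * 'C(n, k)%:R.

(** The leading 1 is the missing term k = 0; the full sum is the binomial expansion of the integral
    of (1 - r^2)^n over [0, 1]. *)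
Lemma one_sub_coefB n :
  1 - coefB n = \sum_(k < n.+1) (-1) ^+ k / (2 * k + 1)%:R * 'C(n, k)%:R.
Proof.
rewrite big_ord_recl /= bin0 expr0 muln0 add0n invr1 !mulr1 /coefB.
rewrite big_add1 /= big_mkord -sumrN; congr (_ + _); apply: eq_bigr => k _.
by rewrite /bump /= add1n addn1 exprS mulN1r !mulNr opprK.
Qed.

(** The Wallis recurrence. Termwise, the difference of the two sides loses its denominator 2k + 1
    and becomes the alternating sum of the binomials of n + 1, that is (1 - 1)^(n + 1) = 0. *)
Lemma one_sub_coefB_rec n :
  (2 * n + 3)%:R * (1 - coefB n.+1) = (2 * n + 2)%:R * (1 - coefB n).
Proof.
have alt0 : \sum_(k < n.+2) (-1) ^+ k * 'C(n.+1, k)%:R = 0 :> R.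
  transitivity ((1 + -1) ^+ n.+1 : R); last by rewrite subrr expr0n.
  by rewrite exprDn; apply: eq_bigr => k _; rewrite expr1n mul1r mulr_natr.
apply/eqP; rewrite -subr_eq0 !one_sub_coefB.
suff <- : \sum_(k < n.+2) (-1) ^+ k * 'C(n.+1, k)%:R =
    (2 * n + 3)%:R * (\sum_(k < n.+2)
      (-1) ^+ k / (2 * k + 1)%:R * 'C(n.+1, k)%:R)
    - (2 * n + 2)%:R * (\sum_(k < n.+1)
      (-1) ^+ k / (2 * k + 1)%:R * 'C(n, k)%:R) :> R by rewrite alt0.
have -> : \sum_(k < n.+1) (-1) ^+ k / (2 * k + 1)%:R * 'C(n, k)%:R =
    \sum_(k < n.+2) (-1) ^+ k / (2 * k + 1)%:R * 'C(n, k)%:R :> R.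
  by rewrite [RHS]big_ord_recr /= bin_small // mulr0 addr0.
rewrite !mulr_sumr -sumrB; apply: eq_bigr => k _.
have kn : (k <= n.+1)%N by rewrite -ltnS.
have binE : (2 * n + 2)%:R * 'C(n, k)%:R =
    (2 * n + 2 - 2 * k)%:R * 'C(n.+1, k)%:R :> R.
  rewrite -!natrM; congr _%:R.
  have -> : (2 * n + 2 - 2 * k = 2 * (n.+1 - k))%N by lia.
  have -> : (2 * n + 2 = 2 * n.+1)%N by lia.
  by rewrite -!mulnA -(mul_bin_down n.+1).
have -> : (2 * n + 2)%:R * ((-1) ^+ k / (2 * k + 1)%:R * 'C(n, k)%:R) =
   (-1) ^+ k / (2 * k + 1)%:R * ((2 * n + 2)%:R * 'C(n, k)%:R) :> R by ring.
rewrite binE natrB; last by lia.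
have k0 : (2 * k + 1)%:R != 0 :> R by rewrite pnatr_eq0 addn1.
by field; rewrite -natrM -[1]/(1%:R) -natrD.
Qed.

Lemma one_sub_coefB_gt0 n : 0 < 1 - coefB n.
Proof.
elim: n => [|n ih]; first by rewrite /coefB big_geq // subr0.
have h : 0 < (2 * n + 3)%:R :> R by rewrite ltr0n addnS.
rewrite -(pmulr_rgt0 _ h) one_sub_coefB_rec pmulr_rgt0 // ltr0n addnS //.
Qed.

(** By the recurrence the right side is 2n times the value at n - 1. Writing the 1 on the left as an
    alternating binomial sum turns each factor 1 / (2k - 1) into 2k / (2k - 1), and absorption, k
    C(n, k) = n C(n - 1, k - 1), matches the two sums term by term. *)
Lemma coefA_coefB n : (0 < n)%N -> 1 + coefA n = (2 * n + 1)%:R * (1 - coefB n).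
Proof.
case: n => // n _.
rewrite (_ : (2 * n.+1 + 1 = 2 * n + 3)%N); last by rewrite mulnS; ring.
rewrite one_sub_coefB_rec one_sub_coefB /coefA big_add1 /= big_mkord.
have alt1 : \sum_(k < n.+1) (-1) ^+ k * 'C(n.+1, k.+1)%:R = 1 :> R.
  apply/eqP; rewrite eq_sym -subr_eq0; apply/eqP.
  transitivity ((1 + -1) ^+ n.+1 : R); last by rewrite subrr expr0n.
  rewrite exprDn [RHS]big_ord_recl /= expr1n mulr1; congr (_ + _).
  rewrite -sumrN; apply: eq_bigr => k _.
  by rewrite expr1n mul1r /bump /= add1n exprS mulN1r mulNrn mulr_natr.
rewrite -[X in X + _]alt1 -big_split /= mulr_sumr; apply: eq_bigr => k _.
rewrite subn1 /= (_ : (2 * k.+1 - 1 = 2 * k + 1)%N); last by rewrite mulnS; lia.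
have binE : (2 * n + 2)%:R * 'C(n, k)%:R =
    (2 * k + 2)%:R * 'C(n.+1, k.+1)%:R :> R.
  rewrite -!natrM; congr _%:R.
  have -> : (2 * n + 2 = 2 * n.+1)%N by lia.
  have -> : (2 * k + 2 = 2 * k.+1)%N by lia.
  by rewrite -!mulnA -(mul_bin_diag n.+1).
have -> : (2 * n + 2)%:R * ((-1) ^+ k / (2 * k + 1)%:R * 'C(n, k)%:R) =
   (-1) ^+ k / (2 * k + 1)%:R * ((2 * n + 2)%:R * 'C(n, k)%:R) :> R by ring.
rewrite binE.
have k0 : (2 * k + 1)%:R != 0 :> R by rewrite pnatr_eq0 addn1.
by field; rewrite -natrM -[1]/(1%:R) -natrD.
Qed.

(** The slope occurs here with even exponents only, so the sign disappears; in [sourceB] the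
    exponents are odd and one factor of the sign survives. *)
Lemma sourceA_unit_slope n u s : s ^+ 2 = 1 ->
  sourceA n u (- s * u) =
  ((2 * n)%:R / (2 * n + 1)%:R + coefA n) * u ^+ (2 * n + 1).
Proof.
move=> s1; rewrite /sourceA mulrDl; congr (_ + _).
rewrite /coefA mulr_suml; apply: eq_big_nat => k /andP[k1 kn].
rewrite exprMn [(- s) ^+ _]exprM sqrrN s1 expr1n mul1r -mulrA -exprD.
by congr (_ * _ ^+ _); lia.
Qed.

Lemma sourceB_unit_slope n u s : s ^+ 2 = 1 ->
  sourceB n u (- s * u) = - s * coefB n * u ^+ (2 * n + 1).
Proof.
move=> s1; rewrite /sourceB /coefB mulr_sumr mulr_suml.
apply: eq_big_nat => k /andP[k1 kn].
rewrite exprMn [(- s) ^+ (_ + 1)]exprD [(- s) ^+ (2 * k)]exprM sqrrN s1.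
rewrite expr1n mul1r expr1.
have -> : (2 * n + 1 = (2 * n - 2 * k) + (2 * k + 1))%N by lia.
rewrite [u ^+ (_ + (_ + _))]exprD; ring.
Qed.

Lemma exists_speed n (c : R) : (0 < n)%N -> 0 < c -> exists a : R, c = speed n a.
Proof.
move=> n0 c0; exists ((c / (1 - coefB n)) `^ (2 * n)%:R^-1).
rewrite /speed -/(coefB n) -powR_mulrn ?powR_ge0 // -powRrM mulVf; last first.
  by rewrite pnatr_eq0 muln_eq0 /= -lt0n.
have g0 := one_sub_coefB_gt0 n.
rewrite powRr1; last by rewrite divr_ge0 // ltW.
by rewrite mulrC divfK // gt_eqF.
Qed.

End Coefficients.

(** * Integrability and value of an integral, carried together *)

Section HasIntegral.
Context d (T : measurableType d) {R : realType}.
Variable mu : {measure set T -> \bar R}.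
Implicit Types (D A B : set T) (f g : T -> R) (v w : R).

(** An integral equation alone says nothing about convergence, since a non-integrable function also
    receives a value. Pairing the two facts yields [convolvable] and the value of [convolution] from
    one computation. *)
Definition has_integral D f v :=
  mu.-integrable D (EFin \o f) /\ \int[mu]_(x in D) f x = v.

Lemma eq_has_integral D f g v : measurable D -> {in D, f =1 g} ->
  has_integral D f v -> has_integral D g v.
Proof.
move=> mD fg [fi fv]; split; last by rewrite -fv; apply/esym/eq_Rintegral.
by apply: eq_integrable fi => // x xD /=; rewrite fg.
Qed.

Lemma has_integralZ D f v k : measurable D ->
  has_integral D f v -> has_integral D (fun x => k * f x) (k * v).
Proof.
move=> mD [fi fv]; split; last by rewrite RintegralZl // fv.
by have := integrableZl mD k fi.
Qed.

Lemma has_integralD D f g v w : measurable D ->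
  has_integral D f v -> has_integral D g w ->
  has_integral D (fun x => f x + g x) (v + w).
Proof.
move=> mD [fi fv] [gi gw]; split; last by rewrite RintegralD // fv gw.
by have := integrableD mD fi gi.
Qed.

Lemma has_integral_mkcond D f v : measurable D ->
  has_integral D f v <-> has_integral setT (f \_ D) v.
Proof.
move=> mD; rewrite /has_integral -Rintegral_mkcond -restrict_EFin.
have e := @integrable_mkcond _ _ _ mu D (EFin \o f) mD.
by split => -[/e fi fv]; split.
Qed.

Lemma has_integral_setU A B f v w : measurable A -> measurable B ->
  A `&` B = set0 -> has_integral A f v -> has_integral B f w ->
  has_integral (A `|` B) f (v + w).
Proof.
move=> mA mB AB /(has_integral_mkcond f v mA) fA /(has_integral_mkcond f w mB) fB.
apply/has_integral_mkcond; first exact: measurableU.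
apply: eq_has_integral (has_integralD _ fA fB) => // x _.
rewrite !patchE; have [xA|xA] := boolP (x \in A).
  rewrite (_ : x \in B = false) ?in_setU ?xA ?addr0 //.
  apply/negP => xB; suff : (A `&` B) x by rewrite AB.
  by split; exact/set_mem.
by rewrite in_setU (negbTE xA) add0r.
Qed.

End HasIntegral.

(** * Integrals of piecewise exponential functions on the line *)

Section PiecewiseExponential.
Context {R : realType}.
Local Notation mu := (@lebesgue_measure R).
Implicit Types (f : R -> R) (b l r k j y : R).

Lemma is_derive_exp_affine k b y :
  is_derive y 1 (fun y => expR (k * (y - b))) (k * expR (k * (y - b))).
Proof.
have H : is_derive y 1 (fun y => k * (y - b)) k.
  by apply: is_derive_eq; rewrite subr0 /GRing.scale /= mulr1.
rewrite mulrC.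
exact: (@is_derive1_comp _ expR (fun y => k * (y - b)) y _ _ (is_derive_expR _) H).
Qed.

Lemma continuous_exp_affine k b : continuous (fun y => expR (k * (y - b))).
Proof.
move=> y; apply: differentiable_continuous; apply/derivable1_diffP.
by case: (is_derive_exp_affine k b y).
Qed.

Lemma has_integral_exp_right k b : 0 < k ->
  has_integral mu `[b, +oo[ (fun y => expR (- k * (y - b))) k^-1.
Proof.
move=> k0.
have iE : (\int[mu]_(y in `[b, +oo[) (expR (- k * (y - b)))%:E = (k^-1)%:E)%E.
  rewrite (@ge0_continuous_FTC2y _ _
    (fun y => - k^-1 * expR (- k * (y - b))) _ 0).
  - by rewrite subrr mulr0 expR0 mulr1 EFinN oppeK add0e.
  - by move=> y _; exact: expR_ge0.
  - exact/continuous_subspaceT/continuous_exp_affine.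
  - rewrite -[X in _ --> X](mulr0 (- k^-1)); apply: cvgMr.
    have lin : k * (y - b) @[y --> +oo] --> +oo.
      by apply: gt0_cvgMry => //; exact: cvg_addrr.
    under eq_cvg do rewrite mulNr.
    exact: (@cvg_comp _ _ _ (fun y => k * (y - b)) (fun z => expR (- z)) _ _ _
      lin (@cvgr_expR R)).
  - move=> y _.
    by have [D _] := is_derive_exp_affine (- k) b y; exact: derivableZ.
  - apply: cvg_at_right_filter; apply: cvgMr.
    exact: continuous_exp_affine.
  - move=> y _; have [D De] := is_derive_exp_affine (- k) b y.
    rewrite derive1E deriveZ // De /GRing.scale /= mulrA mulrNN mulVf ?mul1r //.
    by rewrite gt_eqF.
split; last by rewrite /Rintegral iE.
apply/integrableP; split.
  apply/measurable_EFinP; apply: measurable_funTS; apply: continuous_measurable_fun.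
  exact: continuous_exp_affine.
under eq_integral do rewrite /= ger0_norm ?expR_ge0 //.
by rewrite iE ltry.
Qed.

Lemma has_integral_exp_left k b : 0 < k ->
  has_integral mu `]-oo, b[ (fun y => expR (k * (y - b))) k^-1.
Proof.
move=> k0.
have mE D : measurable_fun D (EFin \o (fun y => expR (k * (y - b)))).
  apply/measurable_EFinP; apply: measurable_funTS; apply: continuous_measurable_fun.
  exact: continuous_exp_affine.
have iE : (\int[mu]_(y in `]-oo, b[) (expR (k * (y - b)))%:E = (k^-1)%:E)%E.
  (* Writing b as - - b prepares the reflection y -> - y, which leads to the half-line starting at -
     b. *)
  rewrite integral_itv_bndo_bndc // -[b]opprK.
  rewrite ge0_integration_by_substitutionNy.
  - have [i1 i2] := has_integral_exp_right (- b) k0.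
    rewrite -i2 /Rintegral fineK; last exact: integrable_fin_num.
    apply: eq_integral => y _ /=; congr (expR _)%:E.
    by rewrite !opprK mulNr -mulrN opprD.
  - exact/continuous_subspaceT/continuous_exp_affine.
  - by move=> y _; exact: expR_ge0.
split; last by rewrite /Rintegral iE.
apply/integrableP; split; first exact: mE.
under eq_integral do rewrite /= ger0_norm ?expR_ge0 //.
by rewrite iE ltry.
Qed.

Lemma continuous_integrable_segment l r f : continuous f ->
  mu.-integrable `[l, r] (EFin \o f).
Proof.
move=> cf; apply: continuous_compact_integrable; first exact: segment_compact.
exact: continuous_subspaceT.
Qed.

Lemma has_integral_exp_segment k l r : k != 0 -> l <= r ->
  has_integral mu `[l, r[ (fun y => expR (k * (y - l)))
    ((expR (k * (r - l)) - 1) / k).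
Proof.
move=> k0; have cE := @continuous_exp_affine k l.
rewrite le_eqVlt => /predU1P[<-|lr].
  rewrite subrr mulr0 expR0 subrr mul0r set_itvco0 //; split.
    exact: integrable_set0.
  exact: Rintegral_set0.
have ici := continuous_integrable_segment l r cE.
have ico : mu.-integrable `[l, r[ (EFin \o (fun y => expR (k * (y - l)))).
  by apply: integrableS ici => //; apply: subset_itvl; rewrite bnd_simp.
split => //; rewrite Rintegral_itv_bndo_bndc // /Rintegral.
rewrite (@continuous_FTC2 _ _ (fun y => k^-1 * expR (k * (y - l))) l r lr).
- by rewrite -EFinB /= subrr mulr0 expR0 -mulrBr mulrC.
- exact: continuous_subspaceT.
- split.
  + move=> y _.
    by have [D _] := is_derive_exp_affine k l y; exact: derivableZ.
  + by apply: cvg_at_right_filter => /=; apply: cvgMr; exact: cE.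
  + by apply: cvg_at_left_filter => /=; apply: cvgMr; exact: cE.
- move=> y _; have [D De] := is_derive_exp_affine k l y.
  by rewrite derive1E deriveZ // De /GRing.scale /= mulrA mulVf ?mul1r.
Qed.

(** This is the shape of y |-> p(x - y) e^{-m|y - b|}, whose breakpoints are x and b: both tails
    decay at rate m + 1, and between the breakpoints the rate is m - 1 or 1 - m. Hence [j] may have
    either sign. *)
Lemma has_integral_piecewise_exp f l r k j C1 C2 C3 :
  l <= r -> 0 < k -> j != 0 ->
  (forall y, y < l -> f y = C1 * expR (k * (y - l))) ->
  (forall y, l <= y < r -> f y = C2 * expR (j * (y - l))) ->
  (forall y, r <= y -> f y = C3 * expR (- k * (y - r))) ->
  has_integral mu setT f
    (C1 / k + C2 * ((expR (j * (r - l)) - 1) / j) + C3 / k).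
Proof.
move=> lr k0 j0 f1 f2 f3.
have -> : [set: R] = (`]-oo, l[ `|` `[l, r[) `|` `[r, +oo[.
  apply/esym/seteqP; split => // y _ /=; rewrite !in_itv /= andbT.
  have [yl|ly] := ltP y l; first by left; left.
  by have [yr|ry] := ltP y r; [left; right|right].
apply: has_integral_setU => //.
- exact: measurableU.
- apply/seteqP; split => // y [/= + +]; rewrite !in_itv /= andbT.
  by move=> [yl ry|/andP[_ yr] ry]; lra.
- apply: has_integral_setU => //.
  + apply/seteqP; split => // y [/= + +]; rewrite !in_itv /=.
    by move=> yl /andP[ly _]; lra.
  + apply: eq_has_integral (has_integralZ C1 _ (has_integral_exp_left l k0)) => //.
    by move=> y /set_mem /=; rewrite in_itv /= => /f1->.
  + apply: eq_has_integral (has_integralZ C2 _ (has_integral_exp_segment j0 lr)) => //.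
    by move=> y /set_mem /=; rewrite in_itv /= => /f2->.
- apply: eq_has_integral (has_integralZ C3 _ (has_integral_exp_right r k0)) => //.
  by move=> y /set_mem /=; rewrite in_itv /= andbT => /f3->.
Qed.

End PiecewiseExponential.

(** * Convolution of the Green kernel with powers of the peakon profile *)

Section GreenConvolution.
Context {R : realType}.
Local Notation mu := (@lebesgue_measure R).
Implicit Types (b x y m s : R).

Lemma expRM_eq (p q p' q' : R) : p + q = p' + q' ->
  expR p * expR q = expR p' * expR q'.
Proof. by rewrite -!expRD => ->. Qed.

(** The free weight [s] on the left of the crest treats both parities at once: s = 1 gives the even
    source and s = -1 the odd one. *)
Lemma has_integral_green_right s m b x : 1 < m -> b <= x ->
  has_integral mu setT
    (fun y => green (x - y) *
              ((if b <= y then 1 else s) * expR (- m * `|y - b|)))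
    (2^-1 * ((s / (m + 1) + (m - 1)^-1) * expR (- (x - b)) +
             ((m + 1)^-1 - (m - 1)^-1) * expR (- m * (x - b)))).
Proof.
move=> m1 bx.
have := @has_integral_piecewise_exp R (fun y => green (x - y) *
    ((if b <= y then 1 else s) * expR (- m * `|y - b|))) b x (m + 1) (1 - m)
  (2^-1 * s * expR (- (x - b))) (2^-1 * expR (- (x - b)))
  (2^-1 * expR (- m * (x - b))).
rewrite /green; set v := (X in _ -> _ -> _ -> _ -> _ -> _ -> has_integral _ _ _ X).
move=> /(_ bx) h.
have vE : v = 2^-1 * ((s / (m + 1) + (m - 1)^-1) * expR (- (x - b)) +
    ((m + 1)^-1 - (m - 1)^-1) * expR (- m * (x - b))).
  rewrite /v.
  (* Expressing everything through two exponentials, generalized on the next line, leaves an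
     identity of rational functions. *)
  have -> : expR (- m * (x - b)) = expR (- (x - b)) * expR ((1 - m) * (x - b)).
    by rewrite -expRD; congr expR; ring.
  move: (expR (- (x - b))) (expR ((1 - m) * (x - b))) => E F.
  by field; apply/and3P; split; apply/negP => /eqP; lra.
rewrite -vE; apply: h; first by lra.
- by apply/negP => /eqP; lra.
- move=> y yb; rewrite leNgt yb /= ger0_norm ?ler0_norm; try lra.
  rewrite -!mulrA; congr (_ * _); rewrite !mulrA [_ * s]mulrC -!mulrA.
  by congr (_ * _); apply: expRM_eq; ring.
- move=> y /andP[by_ yx]; rewrite by_ mul1r !ger0_norm; try lra.
  by rewrite -!mulrA; congr (_ * _); apply: expRM_eq; ring.
- move=> y xy; rewrite (le_trans bx xy) mul1r ler0_norm ?ger0_norm; try lra.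
  by rewrite -!mulrA; congr (_ * _); apply: expRM_eq; ring.
Qed.

Lemma has_integral_green_left s m b x : 1 < m -> x <= b ->
  has_integral mu setT
    (fun y => green (x - y) *
              ((if b <= y then 1 else s) * expR (- m * `|y - b|)))
    (2^-1 * ((s / (m - 1) + (m + 1)^-1) * expR (x - b) +
             s * ((m + 1)^-1 - (m - 1)^-1) * expR (m * (x - b)))).
Proof.
move=> m1 xb.
have := @has_integral_piecewise_exp R (fun y => green (x - y) *
    ((if b <= y then 1 else s) * expR (- m * `|y - b|))) x b (m + 1) (m - 1)
  (2^-1 * s * expR (m * (x - b))) (2^-1 * s * expR (m * (x - b)))
  (2^-1 * expR (x - b)).
rewrite /green; set v := (X in _ -> _ -> _ -> _ -> _ -> _ -> has_integral _ _ _ X).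
move=> /(_ xb) h.
have vE : v = 2^-1 * ((s / (m - 1) + (m + 1)^-1) * expR (x - b) +
    s * ((m + 1)^-1 - (m - 1)^-1) * expR (m * (x - b))).
  rewrite /v.
  have -> : expR (x - b) = expR (m * (x - b)) * expR ((m - 1) * (b - x)).
    by rewrite -expRD; congr expR; ring.
  move: (expR (m * (x - b))) (expR ((m - 1) * (b - x))) => E F.
  by field; apply/andP; split; apply/negP => /eqP; lra.
rewrite -vE; apply: h; first by lra.
- by apply/negP => /eqP; lra.
- move=> y yx; rewrite ifF; last by apply/negP; lra.
  rewrite ger0_norm ?ler0_norm; try lra.
  rewrite -!mulrA; congr (_ * _); rewrite !mulrA [_ * s]mulrC -!mulrA.
  by congr (_ * _); apply: expRM_eq; ring.
- move=> y /andP[xy yb]; rewrite ifF; last by apply/negP; lra.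
  rewrite !ler0_norm; try lra.
  rewrite -!mulrA; congr (_ * _); rewrite !mulrA [_ * s]mulrC -!mulrA.
  by congr (_ * _); apply: expRM_eq; ring.
- move=> y by_; rewrite by_ mul1r ler0_norm ?ger0_norm; try lra.
  by rewrite -!mulrA; congr (_ * _); apply: expRM_eq; ring.
Qed.

Definition kink b y : R := if b <= y then 1 else -1.

Lemma kink_sqr b y : kink b y ^+ 2 = 1.
Proof. by rewrite /kink; case: ifP => _; rewrite ?sqrrN expr1n. Qed.

(* For m > 1, v = (m e^{-|x|} - e^{-m|x|})/(m^2 - 1) solves
   v - v'' = e^{-m|x|}, and v' = - m sgn(x) (e^{-|x|} - e^{-m|x|})/(m^2 - 1). *)
Lemma has_integral_green_even m b x : 1 < m ->
  has_integral mu setT (fun y => green (x - y) * expR (- m * `|y - b|))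
    ((m * expR (- `|x - b|) - expR (- m * `|x - b|)) / (m ^+ 2 - 1)).
Proof.
move=> m1.
have mB1 : m - 1 != 0 by apply/negP => /eqP; lra.
have mD1 : m + 1 != 0 by apply/negP => /eqP; lra.
have mS1 : m ^+ 2 - 1 != 0 by rewrite subr_sqr_1 mulf_neq0.
have [bx|/ltW xb] := leP b x.
  have h := has_integral_green_right 1 m1 bx; rewrite ger0_norm; last by lra.
  have -> : (m * expR (- (x - b)) - expR (- m * (x - b))) / (m ^+ 2 - 1) =
    2^-1 * ((1 / (m + 1) + (m - 1)^-1) * expR (- (x - b)) +
             ((m + 1)^-1 - (m - 1)^-1) * expR (- m * (x - b))).
    by field; rewrite mB1 mD1 mS1.
  apply: eq_has_integral h => // y _.
  by rewrite if_same mul1r.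
have h := has_integral_green_left 1 m1 xb; rewrite ler0_norm; last by lra.
have -> : (m * expR (- - (x - b)) - expR (- m * - (x - b))) / (m ^+ 2 - 1) =
    2^-1 * ((1 / (m - 1) + (m + 1)^-1) * expR (x - b) +
             1 * ((m + 1)^-1 - (m - 1)^-1) * expR (m * (x - b))).
  by rewrite opprK mulrNN; field; rewrite mB1 mD1 mS1.
apply: eq_has_integral h => // y _.
by rewrite if_same mul1r.
Qed.

(** Off the crest, s e^{-m|y - b|} is -1/m times the derivative of e^{-m|y - b|}, so the value is
    -1/m times the derivative v' of the even solution. *)
Lemma has_integral_green_odd m b x : 1 < m ->
  has_integral mu setT
    (fun y => green (x - y) * (kink b y * expR (- m * `|y - b|)))
    (kink b x * (expR (- `|x - b|) - expR (- m * `|x - b|)) / (m ^+ 2 - 1)).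
Proof.
move=> m1.
have mB1 : m - 1 != 0 by apply/negP => /eqP; lra.
have mD1 : m + 1 != 0 by apply/negP => /eqP; lra.
have mS1 : m ^+ 2 - 1 != 0 by rewrite subr_sqr_1 mulf_neq0.
rewrite {2}/kink; have [bx|/ltW xb] := leP b x.
  have h := has_integral_green_right (-1) m1 bx; rewrite ger0_norm; last by lra.
  suff -> : 1 * (expR (- (x - b)) - expR (- m * (x - b))) / (m ^+ 2 - 1) =
    2^-1 * ((-1 / (m + 1) + (m - 1)^-1) * expR (- (x - b)) +
             ((m + 1)^-1 - (m - 1)^-1) * expR (- m * (x - b))) by [].
  by field; rewrite mB1 mD1 mS1.
have h := has_integral_green_left (-1) m1 xb; rewrite ler0_norm; last by lra.
suff -> : -1 * (expR (- - (x - b)) - expR (- m * - (x - b))) / (m ^+ 2 - 1) =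
    2^-1 * ((-1 / (m - 1) + (m + 1)^-1) * expR (x - b) +
             -1 * ((m + 1)^-1 - (m - 1)^-1) * expR (m * (x - b))) by [].
by rewrite opprK mulrNN; field; rewrite mB1 mD1 mS1.
Qed.

End GreenConvolution.

(** * Integration by parts across a kink *)

Section KinkedParts.
Context {R : realType}.
Local Notation mu := (@lebesgue_measure R).
Implicit Types (b l r k y : R) (s f df : R -> R).

(** The interval is open so that the crest, where the sign function is left unspecified, can serve
    as an endpoint; l = r is allowed so that pieces may degenerate. *)
Lemma has_integral_derive_oo l r (F G : R -> R) : l <= r ->
  (forall y, is_derive y 1 F (G y)) -> continuous G ->
  has_integral mu `]l, r[ G (F r - F l).
Proof.
move=> + dF cG; rewrite le_eqVlt => /predU1P[<-|lr].
  rewrite subrr set_itvoo0 //; split; first exact: integrable_set0.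
  exact: Rintegral_set0.
have cF : continuous F.
  move=> y; apply: differentiable_continuous; apply/derivable1_diffP.
  by case: (dF y).
have ici := continuous_integrable_segment l r cG.
have ioo : mu.-integrable `]l, r[ (EFin \o G).
  by apply: integrableS ici => //; apply: subset_itv; rewrite bnd_simp.
have ico : mu.-integrable `[l, r[ (EFin \o G).
  by apply: integrableS ici => //; apply: subset_itv; rewrite bnd_simp.
split => //; rewrite Rintegral_itv_obnd_cbnd // Rintegral_itv_bndo_bndc //.
rewrite /Rintegral (@continuous_FTC2 _ G F l r lr) //.
- exact: continuous_subspaceT.
- split; [by move=> y _; case: (dF y)| |].
  + by apply: cvg_at_right_filter; exact: cF.
  + by apply: cvg_at_left_filter; exact: cF.
- by move=> y _; rewrite derive1E; case: (dF y).
Qed.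

Lemma has_integral_exp_parts k b l r f df : l <= r ->
  (forall y, is_derive y 1 f (df y)) -> continuous df ->
  has_integral mu `]l, r[
    (fun y => expR (k * (y - b)) * df y + k * expR (k * (y - b)) * f y)
    (expR (k * (r - b)) * f r - expR (k * (l - b)) * f l).
Proof.
move=> lr dff cdf.
have cf : continuous f.
  move=> y; apply: differentiable_continuous; apply/derivable1_diffP.
  by case: (dff y).
have cE := @continuous_exp_affine R k b.
apply: (@has_integral_derive_oo _ _ (fun y => expR (k * (y - b)) * f y)) => //.
  move=> y; have H := is_deriveM (is_derive_exp_affine k b y) (dff y).
  by apply: is_derive_eq; rewrite /GRing.scale /= [f y * _]mulrC.
move=> y; apply: cvgD; first by apply: cvgM; [exact: cE|exact: cdf].
by apply: cvgM; [apply: cvgMr; exact: cE|exact: cf].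
Qed.

Lemma has_integral_set1 b f : has_integral mu [set b] f 0.
Proof.
split; last by rewrite Rintegral_set1.
rewrite -set_itv1; apply/integrableP; split.
  by rewrite set_itv1; exact: measurable_fun_set1.
by rewrite set_itv1 integral_set1 ltry.
Qed.

Lemma has_integral_itvU b l r f v w : l < b < r ->
  has_integral mu `]l, b[ f v -> has_integral mu `]b, r[ f w ->
  has_integral mu `]l, r[ f (v + w).
Proof.
move=> /andP[lb br] fv fw.
have -> : `]l, r[%classic = `]l, b[ `|` [set b] `|` `]b, r[ :> set R.
  apply/seteqP; split => y /=; rewrite !in_itv /=.
    have [yb|yb|yb] := ltgtP y b => /andP[ly yr].
    - by left; left; rewrite ly.
    - by right.
    - by left; right.
  by move=> [[/andP[ly yb]| ->]|/andP[by_ yr]]; lra.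
(* The added 0 is the contribution of the single point b. *)
rewrite -[v]addr0; apply: has_integral_setU => //.
- exact: measurableU.
- apply/seteqP; split => // y [/= + +]; rewrite !in_itv /=.
  by move=> [/andP[_ yb]|->] /andP[by_ _]; lra.
- apply: has_integral_setU (has_integral_set1 b f) => //.
  apply/seteqP; split => // y [/= + +]; rewrite !in_itv /=.
  by move=> /andP[_ yb] yE; lra.
Qed.

(** The exponential is continuous at b, so the boundary terms of the two sides cancel there and the
    kink leaves no trace. The sign [s] is prescribed only off b, which covers both the kink in x and
    its reversed form in t. *)
Lemma has_integral_kinked_parts k b l r s f df : l <= r ->
  (forall y, b < y -> s y = 1) -> (forall y, y < b -> s y = -1) ->
  (forall y, is_derive y 1 f (df y)) -> continuous df ->
  has_integral mu `]l, r[
    (fun y => expR (- k * `|y - b|) * df y - k * (s y * expR (- k * `|y - b|) * f y))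
    (expR (- k * `|r - b|) * f r - expR (- k * `|l - b|) * f l).
Proof.
move=> lr s1 sN1 dff cdf.
have right l' r' : b <= l' -> l' <= r' -> has_integral mu `]l', r'[
    (fun y => expR (- k * `|y - b|) * df y -
              k * (s y * expR (- k * `|y - b|) * f y))
    (expR (- k * `|r' - b|) * f r' - expR (- k * `|l' - b|) * f l').
  move=> bl l'r'; rewrite !ger0_norm; try lra.
  apply: eq_has_integral (has_integral_exp_parts (- k) b l'r' dff cdf) => //.
  move=> y /set_mem /=; rewrite in_itv /= => /andP[ly yr].
  by rewrite ger0_norm ?s1; [ring|lra|lra].
have left l' r' : r' <= b -> l' <= r' -> has_integral mu `]l', r'[
    (fun y => expR (- k * `|y - b|) * df y -
              k * (s y * expR (- k * `|y - b|) * f y))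
    (expR (- k * `|r' - b|) * f r' - expR (- k * `|l' - b|) * f l').
  move=> rb l'r'; rewrite !ler0_norm ?mulrNN; try lra.
  apply: eq_has_integral (has_integral_exp_parts k b l'r' dff cdf) => //.
  move=> y /set_mem /=; rewrite in_itv /= => /andP[ly yr].
  by rewrite ler0_norm ?sN1 ?mulrNN; [ring|lra|lra].
have [bl|lb] := leP b l; first exact: right.
have [rb|br] := leP r b; first exact: left.
set v := _ - _.
have -> : v = (expR (- k * `|b - b|) * f b - expR (- k * `|l - b|) * f l) +
              (expR (- k * `|r - b|) * f r - expR (- k * `|b - b|) * f b).
  by rewrite /v; ring.
by apply: (@has_integral_itvU b); [lra|apply: left; lra|apply: right; lra].
Qed.

End KinkedParts.

(** * Measurability on the plane, and calculus of space-time test functions *)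

Section PlaneFunctions.
Context {R : realType}.
Implicit Types (f : R * R -> R) (t x y e T M : R).

Lemma nbhs_rat_itv t (U : set R) : nbhs t U ->
  exists q : rat * rat, (`]ratr q.1, ratr q.2[%classic : set R) t /\
    `]ratr q.1, ratr q.2[ `<=` U.
Proof.
move=> /nbhs_ballP[e /= e0 eU].
have /rat_in_itvoo[p] : t - e < t by rewrite ltrBlDr ltrDl.
have /rat_in_itvoo[q] : t < t + e by rewrite ltrDl.
rewrite !in_itv /= => /andP[tq qe] /andP[ep pt]; exists (p, q); split.
  by rewrite /= in_itv /= pt.
move=> y /=; rewrite in_itv /= => /andP[py yq]; apply: eU.
by rewrite /ball /= ltr_distlC; apply/andP; split; lra.
Qed.

(** Second countability: an open set is the union of the rational boxes it contains. All quadruples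
    of rationals serve as indices, and a box not contained in A is replaced by the empty set. *)
Lemma open_measurable_plane (A : set (R * R)) : open A ->
  measurable (A : set (measurableTypeR R * measurableTypeR R)).
Proof.
move=> oA.
pose box (i : (rat * rat) * (rat * rat)) : set (R * R) :=
  `]ratr i.1.1, ratr i.1.2[ `*` `]ratr i.2.1, ratr i.2.2[.
have -> : A = \bigcup_i (if `[< box i `<=` A >] then box i else set0).
  apply/seteqP; split => [[t x] Atx|z [i _]]; last first.
    by case: ifPn => // /asboolP; exact.
  have : nbhs (t, x) A by move: oA; rewrite openE; exact.
  move=> [[U V] /= [/nbhs_rat_itv[p [tp pU]] /nbhs_rat_itv[q [xq qV]]] UVA].
  exists (p, q) => //; rewrite ifT //; apply/asboolP => z [zp zq].
  by apply: UVA; split; [exact: pU|exact: qV].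
apply: countable_bigcupT_measurable => // i; case: ifP => // _.
by apply: measurableX; exact: measurable_itv.
Qed.

Lemma continuous_measurable_plane f : continuous f ->
  measurable_fun setT (f : measurableTypeR R * measurableTypeR R -> R).
Proof.
move=> /continuousP cf; apply: (measurability _ (RGenOpens.measurableE R)).
move=> _ [_ [a [b ->] <-]]; rewrite setTI; apply: open_measurable_plane.
exact/cf/interval_open.
Qed.

Lemma continuous_section1 f x : continuous f -> continuous (fun t => f (t, x)).
Proof.
move=> cf t; apply: (@continuous_comp _ _ _ (fun t => (t, x)) f); last exact: cf.
exact: (cvg_pair cvg_id (cvg_cst x)).
Qed.

Lemma continuous_section2 f t : continuous f -> continuous (fun x => f (t, x)).
Proof.
move=> cf x; apply: (@continuous_comp _ _ _ (fun x => (t, x)) f); last exact: cf.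
exact: (cvg_pair (cvg_cst t) cvg_id).
Qed.

Lemma continuous_bounded_box f T M : continuous f ->
  exists C : R, forall t x, 0 <= t <= T -> `|x| <= M -> `|f (t, x)| <= C.
Proof.
move=> cf; have cK : compact (`[0, T]%classic `*` `[- M, M]%classic : set (R * R)).
  by apply: compact_setX; exact: segment_compact.
have [K0|/set0P K0] :=
    eqVneq (`[0, T]%classic `*` `[- M, M]%classic : set (R * R)) set0.
  exists 0 => t x tT xM; exfalso.
  suff : set0 (t, x) by []; rewrite -K0; split => /=; rewrite in_itv //=.
  by rewrite -ler_norml.
have [|z _ zmax] := compact_EVT_max K0 cK (f := fun z => `|f z|).
  apply: continuous_subspaceT => z; apply: continuous_comp; first exact: cf.
  exact: norm_continuous.
exists `|f z| => t x tT xM; apply: zmax; rewrite inE; split => /=.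
  by rewrite in_itv.
by rewrite in_itv /= -ler_norml.
Qed.

(** Once the derivative exists, its right-hand quotients determine it. This is needed at t = 0,
    because the support condition controls a test function only for t >= 0. *)
Lemma derive_eq0_right (g : R -> R) t e : derivable g t 1 -> 0 < e ->
  (forall h, 0 <= h < e -> g (h + t) = 0) -> 'D_1 g t = 0.
Proof.
move=> /cvg_dnbhs_at_right dg e0 g0; apply: (cvg_unique _ dg) => //.
apply: cvg_near_cst; near=> h.
have h0 : 0 < h by near: h; exact: nbhs_right_gt.
have he : h < e by near: h; exact: nbhs_right_lt.
have gt0 : g t = 0 by rewrite -[t]add0r g0 // lexx.
rewrite /= gt0 [_ *: 1]mulr1 g0 ?subrr ?scaler0 //.
by rewrite ltW.
Unshelve. all: by end_near. Qed.

Variables (T : R) (phi : R * R -> R).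
Hypothesis phiT : spacetime_test_function T phi.

Lemma test_continuous : continuous phi.
Proof. by case: phiT => /(_ 0%N)[]. Qed.

Lemma test_continuous_dt : continuous (fun z => dt phi z.1 z.2).
Proof.
case: phiT => /(_ 1%N)[_ /(_ (1, 0))[_ [c _]]] _ _.
suff -> : (fun z => dt phi z.1 z.2) = 'D_(1, 0) (phi : R^o * R^o -> R^o) by [].
by apply/funext => -[].
Qed.

Lemma test_continuous_dx : continuous (fun z => dx phi z.1 z.2).
Proof.
case: phiT => /(_ 1%N)[_ /(_ (0, 1))[_ [c _]]] _ _.
suff -> : (fun z => dx phi z.1 z.2) = 'D_(0, 1) (phi : R^o * R^o -> R^o) by [].
by apply/funext => -[].
Qed.

Lemma is_derive_dt t x : is_derive t 1 (fun t => phi (t, x)) (dt phi t x).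
Proof.
case: phiT => /(_ 1%N)[_ /(_ (1, 0))[d _]] _ _.
have quotE : (fun h => h^-1 *: (((phi : R^o * R^o -> R^o) \o shift (t, x))
      (h *: (1, 0) : R^o * R^o) - phi (t, x)))
  = (fun h => h^-1 *: (((fun t => phi (t, x)) \o shift t) (h *: 1) - phi (t, x))).
  apply/funext => h /=; congr (_ *: (phi _ - _)); congr pair.
  by rewrite /= scaler0 add0r.
have := d (t, x); rewrite /derivable quotE => d'.
by split => //; rewrite /dt /derive quotE.
Qed.

Lemma is_derive_dx t x : is_derive x 1 (fun x => phi (t, x)) (dx phi t x).
Proof.
case: phiT => /(_ 1%N)[_ /(_ (0, 1))[d _]] _ _.
have quotE : (fun h => h^-1 *: (((phi : R^o * R^o -> R^o) \o shift (t, x))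
      (h *: (0, 1) : R^o * R^o) - phi (t, x)))
  = (fun h => h^-1 *: (((fun x => phi (t, x)) \o shift x) (h *: 1) - phi (t, x))).
  apply/funext => h /=; congr (_ *: (phi _ - _)); congr pair.
  by rewrite /= scaler0 add0r.
have := d (t, x); rewrite /derivable quotE => d'.
by split => //; rewrite /dx /derive quotE.
Qed.

(** The support is compact and the strip is open at T, so the largest time in the support stays
    strictly below T. *)
Lemma test_support : 0 < T -> exists T' M, [/\ 0 < T' < T, 0 < M &
  forall t x, 0 <= t < T -> T' <= t \/ M <= `|x| -> phi (t, x) = 0].
Proof.
move=> T0; case: phiT => _ cK KS.
set K := closure _ in cK KS.
have Kphi t x : 0 <= t < T -> phi (t, x) != 0 -> K (t, x).
  by move=> tT p0; apply: subset_closure.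
have [K0|/set0P K0] := eqVneq K set0.
  exists (T / 2), 1; split => //; first by apply/andP; split; lra.
  move=> t x tT _; apply: contrapT => /eqP p0.
  by have := Kphi _ _ tT p0; rewrite K0.
have [|z1 z1K z1max] := compact_EVT_max K0 cK (f := fst).
  by apply: continuous_subspaceT => z; exact: cvg_fst.
have [|z2 z2K z2max] := compact_EVT_max K0 cK (f := fun z => `|z.2|).
  apply: continuous_subspaceT => z; apply: continuous_comp; first exact: cvg_snd.
  exact: norm_continuous.
have /= /andP[z10 z1T] := KS _ (set_mem z1K).
(* The midpoint and the added 1 leave room, so that [phi] already vanishes at t = T' and at |x| =
   M. *)
exists ((z1.1 + T) / 2), (`|z2.2| + 1); split.
- by apply/andP; split; lra.
- by rewrite ltr_pwDr.
- move=> t x tT tx; apply: contrapT => /eqP /(Kphi _ _ tT) /mem_set txK.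
  have /= h1 := z1max _ txK; have /= h2 := z2max _ txK.
  by case: tx => h; lra.
Qed.

Lemma test_support_dt T' M t x : T' < T ->
  (forall t x, 0 <= t < T -> T' <= t \/ M <= `|x| -> phi (t, x) = 0) ->
  0 <= t < T -> T' <= t \/ M <= `|x| -> dt phi t x = 0.
Proof.
move=> T'T p0 tT tx; have [d <-] := is_derive_dt t x.
apply: (@derive_eq0_right _ _ (T - t)) => //; first by lra.
move=> h hT; apply: p0; first by lra.
by case: tx; [left; lra|right].
Qed.

(** Strictness in M < |x| provides a two-sided neighbourhood of x on which [phi] vanishes; for T' <=
    t it vanishes at every x. *)
Lemma test_support_dx T' M t x :
  (forall t x, 0 <= t < T -> T' <= t \/ M <= `|x| -> phi (t, x) = 0) ->
  0 <= t < T -> T' <= t \/ M < `|x| -> dx phi t x = 0.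
Proof.
move=> p0 tT tx; have [_ <-] := is_derive_dx t x.
rewrite -(derive_cst (0 : R) x (1 : R)); apply: near_eq_derive.
case: tx => [T't|Mx].
  by near=> y; rewrite p0 //; left.
near=> y; rewrite p0 //; right; rewrite ltW //.
near: y; apply: (@cvgr_gt _ _ _ _ (fun y : R => `|y|) `|x|) => //.
exact: norm_continuous.
Unshelve. all: by end_near. Qed.

End PlaneFunctions.

(** * Domination by a finite-measure set, and Fubini for real-valued integrals *)

Section IntegrabilityCriteria.
Context {R : realType}.

Lemma integrable_bounded_support d (T : measurableType d)
    (mu : {measure set T -> \bar R}) (D A : set T) (f : T -> R) (C : R) :
  measurable D -> measurable A -> (mu A < +oo)%E -> measurable_fun D f ->
  (forall x, D x -> `|f x| <= C) -> (forall x, D x -> ~ A x -> f x = 0) ->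
  mu.-integrable D (EFin \o f).
Proof.
move=> mD mA A_oo mf fC f0.
have iA : mu.-integrable D (fun x => C%:E * (\1_A x)%:E)%E.
  apply: integrableZl => //; apply/integrableP; split.
    by apply/measurable_EFinP.
  under eq_integral do rewrite /= ger0_norm //.
  rewrite integral_indic //; apply: le_lt_trans A_oo.
  by apply: le_measure => //; rewrite ?inE //; exact: measurableI.
apply: le_integrable iA => //; first exact/measurable_EFinP.
move=> x Dx; rewrite /= lee_fin normrM indicE.
have [/set_mem xA|xA] := boolP (x \in A).
  by rewrite normr1 mulr1 (le_trans (fC _ Dx)) // ler_norm.
by rewrite f0 ?normr0 ?mulr0 // => /mem_set; exact/negP.
Qed.

(** The real inner integral is [fine] of the extended one, and agrees with it where that is finite,
    hence for almost every section. *)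
Lemma Fubini_Rintegral d1 d2 (T1 : measurableType d1) (T2 : measurableType d2)
    (m1 : {sigma_finite_measure set T1 -> \bar R})
    (m2 : {sigma_finite_measure set T2 -> \bar R}) (f : T1 * T2 -> R) :
  (m1 \x m2)%E.-integrable setT (EFin \o f) ->
  \int[m1]_x (\int[m2]_y f (x, y)) = \int[m2]_y (\int[m1]_x f (x, y)).
Proof.
move=> fi; rewrite /Rintegral.
have -> : (\int[m1]_x (fine (\int[m2]_y (f (x, y))%:E))%:E =
           \int[m1]_x \int[m2]_y (f (x, y))%:E)%E.
  have mF := measurable_fubini_F fi.
  apply: ae_eq_integral => //.
    by apply/measurable_EFinP; apply: (measurableT_comp (fine_measurable _)).
  apply: filterS (ae_integrable1 fi) => x ix _.
  by rewrite fineK //; exact: integrable_fin_num ix.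
have -> : (\int[m2]_y (fine (\int[m1]_x (f (x, y))%:E))%:E =
           \int[m2]_y \int[m1]_x (f (x, y))%:E)%E.
  have mG := measurable_fubini_G fi.
  apply: ae_eq_integral => //.
    by apply/measurable_EFinP; apply: (measurableT_comp (fine_measurable _)).
  apply: filterS (ae_integrable2 fi) => y iy _.
  by rewrite fineK //; exact: integrable_fin_num iy.
by rewrite (Fubini fi).
Qed.

End IntegrabilityCriteria.

(** * Norm bounds and the weak derivative of the peakon profile *)

Section PeakonProfile.
Context {R : realType}.
Local Notation mu := (@lebesgue_measure R).
Local Notation plane := (measurableTypeR R * measurableTypeR R)%type.
Implicit Types (a b c k p x y M : R) (f : R -> R).

Lemma measurable_profile k c :
  measurable_fun setT (fun z : plane => expR (- k * `|z.2 - c * z.1|)).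
Proof.
apply: (@continuous_measurable_plane R (fun z => expR (- k * `|z.2 - c * z.1|))).
move=> z; apply: continuous_comp; last exact: continuous_expR.
apply: cvgMr; apply: cvg_norm; apply: cvgB; first exact: cvg_snd.
by apply: cvgMr; exact: cvg_fst.
Qed.

Lemma measurable_kink c :
  measurable_fun setT (fun z : plane => kink (c * z.1) z.2).
Proof.
rewrite /kink; apply: measurable_fun_ifT => //.
apply: measurable_fun_ler; last exact: measurable_snd.
by apply: measurable_funM => //; exact: measurable_fst.
Qed.

Lemma measurable_profile_section k b :
  measurable_fun setT (fun x => expR (- k * `|x - b|)).
Proof.
apply: continuous_measurable_fun => x.
apply: continuous_comp; last exact: continuous_expR.
by apply: cvgMr; apply: cvg_norm; apply: cvgB; [exact: cvg_id|exact: cvg_cst].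
Qed.

Lemma measurable_kink_section b : measurable_fun setT (kink b : R -> R).
Proof.
by rewrite /kink; apply: measurable_fun_ifT => //; exact: measurable_fun_ler.
Qed.

Lemma normr_kink b y : `|kink b y| = 1 :> R.
Proof. by rewrite /kink; case: ifP; rewrite ?normrN normr1. Qed.

Lemma normr_profile_le1 x : `|expR (- `|x|)| <= 1 :> R.
Proof. by rewrite ger0_norm ?expR_ge0 // expR_le1 oppr_le0. Qed.

Lemma has_integral_profile k b : 0 < k ->
  has_integral mu setT (fun y => expR (- k * `|y - b|)) (k^-1 + k^-1).
Proof.
move=> k0.
(* Both breakpoints sit at the crest, so the middle piece is empty and receives coefficient 0. *)
have := @has_integral_piecewise_exp R (fun y => expR (- k * `|y - b|)) b b k 1 1 0 1
  (lexx b) k0 (oner_neq0 _).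
rewrite mul0r addr0 mul1r; apply.
- by move=> y yb; rewrite ler0_norm ?mul1r ?mulrNN //; lra.
- by move=> y yb; exfalso; lra.
- by move=> y yb; rewrite ger0_norm ?mul1r //; lra.
Qed.

(** The bound is the exact p-norm of a e^{-|x - b|}. It does not depend on b, hence is uniform in t
    when b = c t. *)
Lemma Lnorm_le_profile p a b f : 0 < p -> measurable_fun setT f ->
  (forall x, `|f x| <= `|a| * expR (- `|x - b|)) ->
  ('N[mu]_p%:E [EFin \o f] <= ((`|a| `^ p * (p^-1 + p^-1)) `^ p^-1)%:E)%E.
Proof.
move=> p0 mf fa; rewrite unlock -poweR_EFin; apply: gt0_ler_poweR.
- by rewrite invr_ge0 ltW.
- by rewrite in_itv /= leey andbT; apply: integral_ge0.
- rewrite in_itv /= leey andbT lee_fin mulr_ge0 ?powR_ge0 //.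
  by rewrite addr_ge0 // invr_ge0 ltW.
have [i1 i2] := has_integralZ (`|a| `^ p) measurableT (has_integral_profile b p0).
rewrite -i2 /Rintegral fineK; last exact: integrable_fin_num.
apply: ge0_le_integral => //.
- by move=> x _; exact: poweR_ge0.
- apply: (measurableT_comp (measurable_poweR _)).
  by apply: measurableT_comp => //; exact/measurable_EFinP.
- apply/measurable_EFinP; apply: measurable_funM => //.
  exact: measurable_profile_section.
- move=> x _; rewrite /= lee_fin mulNr [p * _]mulrC -mulNr expRM.
  rewrite -powRM ?expR_ge0 //; apply: ge0_ler_powR; rewrite ?nnegrE //.
  exact: ltW.
Qed.

Lemma integrable_mul_compact f g M C : measurable_fun setT f ->
  (forall x, `|f x| <= C) -> continuous g ->
  (forall x, M < `|x| -> g x = 0) ->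
  mu.-integrable setT (EFin \o (fun x => f x * g x)).
Proof.
move=> mf fC cg g0.
(* Using |M| keeps the segment non-empty whatever the sign of M. *)
have [z _ zmax] : exists2 z, z \in `[- (`|M|), `|M|]%classic &
    forall x, x \in `[- (`|M|), `|M|]%classic -> `|g x| <= `|g z|.
  apply: compact_EVT_max; first 2 last.
  - apply: continuous_subspaceT => x; apply: continuous_comp; first exact: cg.
    exact: norm_continuous.
  - by exists 0; rewrite /= in_itv /= oppr_le0 normr_ge0.
  - exact: segment_compact.
apply: (@integrable_bounded_support R _ (measurableTypeR R) mu setT
  `[- (`|M|), `|M|]%classic (fun x => f x * g x) (C * `|g z|)) => //.
- exact: compact_finite_measure (@segment_compact _ _ _).
- by apply: measurable_funM => //; exact: continuous_measurable_fun.
- have C0 : 0 <= C by exact: le_trans (fC 0).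
  move=> x _; rewrite normrM; have [xM|Mx] := leP `|x| `|M|; last first.
    by rewrite g0 ?normr0 ?mulr0 ?mulr_ge0 // (le_lt_trans (ler_norm _) Mx).
  by rewrite ler_pM // zmax // inE /= in_itv /= -ler_norml.
- move=> x _ /= /negP; rewrite in_itv /= -ler_norml -ltNge => Mx.
  by rewrite g0 ?mulr0 // (le_lt_trans (ler_norm _) Mx).
Qed.

(* The kink value at the crest is a convention: the a.e. derivative is chosen
   with |u_x| = |u| everywhere, so that the source terms are pure powers. *)
Definition peakon_slope a c t x : R := - kink (c * t) x * peakon a c t x.

Lemma measurable_peakon a c :
  measurable_fun setT (fun z : plane => peakon a c z.1 z.2).
Proof.
apply: measurable_funM => //; have := measurable_profile 1 c.
by apply: eq_measurable_fun => z _; rewrite mulN1r.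
Qed.

Lemma measurable_peakon_slope a c :
  measurable_fun setT (fun z : plane => peakon_slope a c z.1 z.2).
Proof.
apply: measurable_funM; last exact: measurable_peakon.
by apply: measurableT_comp => //; exact: measurable_kink.
Qed.

Lemma measurable_profile1 b : measurable_fun setT (fun x => expR (- `|x - b|)).
Proof.
have := measurable_profile_section 1 b.
by apply: eq_measurable_fun => x _; rewrite mulN1r.
Qed.

Lemma test_function_C1 (psi : R -> R) : test_function psi ->
  [/\ forall y, is_derive y 1 psi (derive1 psi y), continuous psi,
      continuous (derive1 psi) &
      exists2 M : R, 0 < M &
        forall x : R, M <= `|x| -> psi x = 0 /\ derive1 psi x = 0].
Proof.
move=> [/(_ 1%N)[cpsi /(_ 1)[dpsi [cdpsi _]]] cK].
have d1E : derive1 psi = 'D_1 (psi : R^o -> R^o).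
  by apply/funext => y; rewrite derive1E.
split => //; first by move=> y; rewrite derive1E; exact: derivableP.
  by rewrite d1E.
have [M M0 MK] : exists2 M : R, 0 < M & forall x, M <= `|x| ->
    ~ closure [set x | psi x != 0] x.
  have [K0|/set0P K0] := eqVneq (closure [set x | psi x != 0]) set0.
    by exists 1 => // x _; rewrite K0.
  have [|z zK zmax] := compact_EVT_max K0 cK (f := fun z => `|z|).
    by apply: continuous_subspaceT; exact: norm_continuous.
  exists (`|z| + 1); first by rewrite ltr_pwDr.
  by move=> x zx /mem_set /zmax; lra.
exists M => // x /MK xK; split.
  by apply: contrapT => /eqP p0; apply: xK; exact: subset_closure.
rewrite derive1E -(derive_cst (0 : R) x (1 : R)); apply: near_eq_derive.
have : open (~` closure [set x | psi x != 0]).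
  exact/closed_openC/closed_closure.
rewrite openE => /(_ _ xK).
apply: filterS => y yK; apply: contrapT => /eqP p0; apply: yK.
exact: subset_closure.
Qed.

Lemma weak_derivative_profile a b :
  weak_derivative (fun x => a * expR (- `|x - b|))
                  (fun x => - kink b x * (a * expR (- `|x - b|))).
Proof.
have [iE _] := has_integral_profile b (@ltr01 R).
have mE := measurable_profile1 b.
have mK := measurable_kink_section b.
(* The function and its derivative are both a weight bounded by |a| times the exponential, with
   weights a and - kink * a. *)
have loc (w : R -> R) : measurable_fun setT w -> (forall x, `|w x| <= `|a|) ->
    locally_integrable [set: R] (fun x => w x * expR (- `|x - b|)).
  move=> mw wa; apply: open_integrable_locally; first exact: openT.
  have := integrableZl measurableT `|a| iE; apply: le_integrable => //.
    by apply/measurable_EFinP; exact: measurable_funM.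
  move=> x _; rewrite /= lee_fin !normrM normr_id mulN1r.
  by rewrite ler_wpM2r.
split.
- exact: (loc (cst a)).
- under eq_fun do rewrite mulrA.
  apply: (loc (fun x => - kink b x * a)).
    by apply: measurable_funM => //; exact: measurableT_comp.
  by move=> x; rewrite normrM normrN normr_kink mul1r.
- move=> psi /test_function_C1[dpsi cpsi cdpsi [M M0 psi0]].
  have iA : mu.-integrable setT (EFin \o
      (fun x => (a * expR (- `|x - b|)) * derive1 psi x)).
    apply: (@integrable_mul_compact _ _ M `|a|) => //.
    + exact: measurable_funM.
    + by move=> x; rewrite normrM ler_piMr // normr_profile_le1.
    + by move=> x /ltW /psi0[].
  have iB : mu.-integrable setT (EFin \o
      (fun x => (- kink b x * (a * expR (- `|x - b|))) * psi x)).
    apply: (@integrable_mul_compact _ _ M `|a|) => //.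
    + apply: measurable_funM; last exact: measurable_funM.
      exact: measurableT_comp.
    + move=> x; rewrite normrM normrN normr_kink mul1r normrM.
      by rewrite ler_piMr // normr_profile_le1.
    + by move=> x /ltW /psi0[].
  (* With both terms on one side, the integrand is a times that of the kinked integration by parts
     for k = 1; [psi] vanishes at both ends of ]-M, M[. *)
  apply/eqP; rewrite -addr_eq0 -RintegralD //; apply/eqP.
  have MM : - M <= M by lra.
  have := @has_integral_kinked_parts R 1 b (- M) M (kink b) psi (derive1 psi) MM.
  have [pM _] := psi0 M (ler_norm _).
  have [pNM _] : psi (- M) = 0 /\ derive1 psi (- M) = 0.
    by apply: psi0; rewrite normrN ler_norm.
  rewrite pM pNM !mulr0 subrr => h.
  have {}h := h _ _ dpsi cdpsi.
  have {}h : has_integral mu `]-M, M[ (fun y =>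
      expR (- 1 * `|y - b|) * derive1 psi y -
      1 * (kink b y * expR (- 1 * `|y - b|) * psi y)) 0.
    apply: h => y yb; rewrite /kink; first by rewrite ltW.
    by rewrite leNgt yb.
  have mI : measurable (`]-M, M[%classic : set (measurableTypeR R)) by [].
  have [_] := (has_integral_mkcond _ _ _ mI).1 (has_integralZ a mI h).
  rewrite mulr0 => <-.
  apply: eq_Rintegral => x _; rewrite patchE.
  case: ifPn => [_|xM]; first by rewrite !mulN1r mul1r; ring.
  have [-> ->] : psi x = 0 /\ derive1 psi x = 0.
    apply: psi0; rewrite leNgt; apply/negP => xM'; move/negP: xM; apply.
    by rewrite inE /= in_itv /= -ltr_norml.
  by rewrite !mulr0 addr0.
Qed.

End PeakonProfile.

(** * Sobolev regularity of the peakon, and its weak integrand in closed form *)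

Section PeakonSolution.
Context {R : realType}.
Local Notation mu := (@lebesgue_measure R).
Local Notation plane := (measurableTypeR R * measurableTypeR R)%type.
Implicit Types (a b c p t x y M : R) (n : nat).

Lemma W1_profile p a : 1 <= p -> W1 p (fun x : R => a * expR (- `|x|)).
Proof.
move=> p1; have p0 : 0 < p by exact: lt_le_trans p1.
have LfunW (f : R -> R) : measurable_fun setT f ->
    (forall x, `|f x| <= `|a| * expR (- `|x - 0|)) -> f \in Lfun mu p%:E.
  move=> mf fa; rewrite inE /=; apply/andP; split; rewrite inE //=.
  by apply: le_lt_trans (Lnorm_le_profile p0 mf fa) _; rewrite ltry.
have mE : measurable_fun setT (fun x : R => expR (- `|x - 0|)).
  exact: measurable_profile1.
have mK := @measurable_kink_section R 0.
have eqE : (fun x : R => a * expR (- `|x|)) = (fun x => a * expR (- `|x - 0|)).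
  by apply/funext => x; rewrite subr0.
rewrite eqE; exists (fun x => - kink 0 x * (a * expR (- `|x - 0|))); split.
- apply: LfunW; first exact: measurable_funM.
  by move=> x; rewrite normrM [`|expR _|]ger0_norm // expR_ge0.
- apply: LfunW.
    apply: measurable_funM; last exact: measurable_funM.
    exact: measurableT_comp.
  move=> x; rewrite normrM normrN normr_kink mul1r normrM.
  by rewrite [`|expR _|]ger0_norm // expR_ge0.
- exact: weak_derivative_profile.
Qed.

Lemma normr_patch_le (K : set R) (f : R -> R) x : `|(f \_ K) x| <= `|f x|.
Proof. by rewrite patchE; case: ifP => // _; rewrite normr0. Qed.

Lemma Linfloc_W1loc_peakon T p a c : 1 <= p ->
  Linfloc_W1loc T p (peakon a c) (peakon_slope a c).
Proof.
move=> p1; have p0 : 0 < p by exact: lt_le_trans p1.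
split.
- by apply: measurable_funTS; exact: measurable_peakon.
- by apply: measurable_funTS; exact: measurable_peakon_slope.
- by apply: aeW => t _; exact: weak_derivative_profile.
- move=> T' K _ cK.
  (* A bound independent of both t and K, since restricting to K only decreases absolute values. *)
  pose B := (`|a| `^ p * (p^-1 + p^-1)) `^ p^-1.
  have mK : measurable (K : set (measurableTypeR R)) by exact: compact_measurable.
  apply: (@le_lt_trans _ _ (B%:E + B%:E)%E); last by rewrite -EFinD ltry.
  apply/ess_supP; apply: aeW => t; rewrite patchE; case: ifP => _; last first.
    by rewrite -EFinD lee_fin addr_ge0 // powR_ge0.
  have mE := measurable_profile1 (c * t).
  have mS := measurable_kink_section (c * t).
  apply: leeD; apply: (Lnorm_le_profile (b := c * t)) => //.
  + apply/(measurable_restrictT _ mK); apply: measurable_funTS.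
    exact: measurable_funM.
  + move=> x; apply: le_trans (normr_patch_le _ _ _) _.
    by rewrite normrM [`|expR _|]ger0_norm // expR_ge0.
  + apply/(measurable_restrictT _ mK); apply: measurable_funTS.
    apply: measurable_funM; last exact: measurable_funM.
    exact: measurableT_comp.
  + move=> x; apply: le_trans (normr_patch_le _ _ _) _.
    rewrite normrM normrN normr_kink mul1r.
    by rewrite normrM [`|expR _|]ger0_norm // expR_ge0.
Qed.

(** The constant A of the overview, with [coefB] as B. *)
Definition massA n : R := (2 * n)%:R / (2 * n + 1)%:R + coefA n.

Lemma peakonX a c t y j :
  peakon a c t y ^+ j = a ^+ j * expR (- j%:R * `|y - c * t|).
Proof. by rewrite exprMn -expRM_natl mulrN mulNr. Qed.

Lemma sourceA_peakon n a c t y :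
  sourceA n (peakon a c t y) (peakon_slope a c t y) =
  massA n * a ^+ (2 * n + 1) * expR (- (2 * n + 1)%:R * `|y - c * t|).
Proof. by rewrite sourceA_unit_slope ?kink_sqr // peakonX mulrA. Qed.

Lemma sourceB_peakon n a c t y :
  sourceB n (peakon a c t y) (peakon_slope a c t y) =
  - coefB n * a ^+ (2 * n + 1) *
  (kink (c * t) y * expR (- (2 * n + 1)%:R * `|y - c * t|)).
Proof. by rewrite sourceB_unit_slope ?kink_sqr // peakonX; ring. Qed.

Lemma degree_gt1 n : (0 < n)%N -> 1 < (2 * n + 1)%:R :> R.
Proof. by move=> n0; rewrite ltr1n; lia. Qed.

Lemma has_integral_green_sourceA n a c t x : (0 < n)%N ->
  has_integral mu setT
    (fun y => green (x - y) * sourceA n (peakon a c t y) (peakon_slope a c t y))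
    (massA n * a ^+ (2 * n + 1) *
     (((2 * n + 1)%:R * expR (- `|x - c * t|)
       - expR (- (2 * n + 1)%:R * `|x - c * t|)) / ((2 * n + 1)%:R ^+ 2 - 1))).
Proof.
move=> n0; have h := has_integral_green_even (c * t) x (degree_gt1 n0).
apply: eq_has_integral (has_integralZ _ measurableT h) => // y _.
by rewrite sourceA_peakon mulrCA.
Qed.

Lemma has_integral_green_sourceB n a c t x : (0 < n)%N ->
  has_integral mu setT
    (fun y => green (x - y) * sourceB n (peakon a c t y) (peakon_slope a c t y))
    (- coefB n * a ^+ (2 * n + 1) *
     (kink (c * t) x * (expR (- `|x - c * t|)
       - expR (- (2 * n + 1)%:R * `|x - c * t|)) / ((2 * n + 1)%:R ^+ 2 - 1))).
Proof.
move=> n0; have h := has_integral_green_odd (c * t) x (degree_gt1 n0).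
apply: eq_has_integral (has_integralZ _ measurableT h) => // y _.
by rewrite sourceB_peakon mulrCA.
Qed.

(* Coefficients of e^{-|x - ct|} and e^{-m|x - ct|}, with m = 2n + 1, in the
   function u^m / m + p * sourceA multiplying phi_x. *)
Definition fluxE n a : R :=
  massA n * a ^+ (2 * n + 1) * (2 * n + 1)%:R / ((2 * n + 1)%:R ^+ 2 - 1).

Definition fluxEm n a : R :=
  a ^+ (2 * n + 1) *
  ((2 * n + 1)%:R^-1 - massA n / ((2 * n + 1)%:R ^+ 2 - 1)).

(* The terms without derivatives of phi combine by the identity
   m massA + coefB = (m^2 - 1)(1 - coefB), where m = 2n + 1. *)
Lemma weak_integrand_peakon n a c phi t x : (0 < n)%N -> c = speed n a ->
  weak_integrand n (peakon a c) (peakon_slope a c) phi t x =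
  a * expR (- `|x - c * t|) * dt phi t x
  + (fluxE n a * expR (- `|x - c * t|)
     + fluxEm n a * expR (- (2 * n + 1)%:R * `|x - c * t|)) * dx phi t x
  + kink (c * t) x * ((a * c - fluxE n a) * expR (- `|x - c * t|)
     - (2 * n + 1)%:R * fluxEm n a * expR (- (2 * n + 1)%:R * `|x - c * t|))
    * phi (t, x).
Proof.
move=> n0 cE; rewrite /weak_integrand.
have [_] := has_integral_green_sourceA a c t x n0.
rewrite -/(convolution green _ x) => ->.
have [_] := has_integral_green_sourceB a c t x n0.
rewrite -/(convolution green _ x) => ->.
rewrite sourceB_peakon peakonX /peakon.
(* Here the relation between speed and height enters. *)
have ac : a * c = (1 - coefB n) * a ^+ (2 * n + 1).
  by rewrite [in LHS]cE /speed -/(coefB n) addn1 exprS; ring.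
have mA : massA n = (2 * n + 1)%:R * (1 - coefB n) - (2 * n + 1)%:R^-1.
  have := coefA_coefB (R := R) n0.
  have m0 : (2 * n + 1)%:R != 0 :> R by rewrite pnatr_eq0 addn1.
  rewrite /massA.
  have -> : (2 * n)%:R = (2 * n + 1)%:R - 1 :> R by rewrite natrD addrK.
  move=> h; have -> : coefA n = (2 * n + 1)%:R * (1 - coefB n) - 1 :> R.
    by rewrite -h addrC addKr.
  by field.
rewrite ac /fluxE /fluxEm mA.
have m1 := degree_gt1 n0.
move: (2 * n + 1)%:R m1 {mA ac} (expR _) (expR _) (kink _ _) (a ^+ _) (coefB n)
  (dt _ _ _) (dx _ _ _) (phi _) => m m1 E Em s A B P Q F.
have m0 : m != 0 by apply/negP => /eqP; lra.
have mS1 : m ^+ 2 - 1 != 0.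
  by rewrite subr_sqr_1 mulf_neq0 //; apply/negP => /eqP; lra.
by field; rewrite m0 mS1.
Qed.

End PeakonSolution.

(** * The weak form against a fixed test function *)

Section WeakForm.
Context {R : realType}.
Local Notation mu := (@lebesgue_measure R).
Local Notation plane := (measurableTypeR R * measurableTypeR R)%type.
Variables (n : nat) (a c T T' M : R) (phi : R * R -> R).
Implicit Types (t x : R).
Hypothesis n0 : (0 < n)%N.
Hypothesis c0 : 0 < c.
Hypothesis cE : c = speed n a.
Hypothesis phiT : spacetime_test_function T phi.
Hypothesis T'T : 0 < T' < T.
Hypothesis M0 : 0 < M.
Hypothesis phi0 : forall t x : R, 0 <= t < T ->
  T' <= t \/ M <= `|x| -> phi (t, x) = 0.

Let E t x := expR (- `|x - c * t|).
Let Em t x := expR (- (2 * n + 1)%:R * `|x - c * t|).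

(** Off the crest this is the t-derivative of a E phi, because E_t = c s E there. *)
Definition transport t x : R :=
  a * E t x * dt phi t x + a * c * (kink (c * t) x * E t x) * phi (t, x).

(** Off the crest this is the x-derivative of ([fluxE] E + [fluxEm] E^m) phi, so it integrates to 0
    at each time. *)
Definition flux t x : R :=
  fluxE n a * (E t x * dx phi t x - kink (c * t) x * E t x * phi (t, x))
  + fluxEm n a * (Em t x * dx phi t x
      - (2 * n + 1)%:R * (kink (c * t) x * Em t x * phi (t, x))).

Lemma weak_integrand_split t x :
  weak_integrand n (peakon a c) (peakon_slope a c) phi t x =
  transport t x + flux t x.
Proof.
rewrite weak_integrand_peakon // /transport /flux /E /Em; ring.
Qed.

Lemma phi_out t x : 0 <= t < T -> M < `|x| -> phi (t, x) = 0.
Proof. by move=> tT Mx; apply: phi0 => //; right; exact: ltW. Qed.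

Lemma dt_out t x : 0 <= t < T -> T' <= t \/ M < `|x| -> dt phi t x = 0.
Proof.
move=> tT tx; apply: (test_support_dt phiT (T' := T') (M := M)) => //.
  by case/andP: T'T.
by case: tx => [|/ltW]; [left|right].
Qed.

Lemma dx_out t x : 0 <= t < T -> T' <= t \/ M < `|x| -> dx phi t x = 0.
Proof. by move=> tT tx; apply: (test_support_dx phiT phi0). Qed.

Lemma has_integral_flux t : 0 <= t < T -> has_integral mu setT (flux t) 0.
Proof.
move=> tT.
have cphi := @continuous_section2 R _ t (test_continuous phiT).
have cdx := @continuous_section2 R _ t (test_continuous_dx phiT).
(* The x-derivative of [phi] is known to vanish only for |x| > M; enlarging M makes it vanish for
   all |x| >= N. *)
pose N : R := M + 1.
have N0 : 0 <= N by rewrite addr_ge0 // ltW.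
have NN : - N <= N by rewrite (le_trans _ N0) // oppr_le0.
have out x : N <= `|x| -> phi (t, x) = 0 /\ dx phi t x = 0.
  move=> Nx; have Mx : M < `|x| by rewrite (lt_le_trans _ Nx) // ltrDl.
  by rewrite phi_out ?dx_out //; right.
have [phiN _] := out N (ler_norm _).
have [phiNN _] : phi (t, - N) = 0 /\ dx phi t (- N) = 0.
  by apply: out; rewrite normrN ler_norm.
have parts k : has_integral mu `]-N, N[ (fun x =>
    expR (- k * `|x - c * t|) * dx phi t x
    - k * (kink (c * t) x * expR (- k * `|x - c * t|) * phi (t, x))) 0.
  have := @has_integral_kinked_parts R k (c * t) (- N) N (kink (c * t))
    (fun x => phi (t, x)) (dx phi t) NN.
  rewrite phiN phiNN !mulr0 subrr => h.
  apply: h (is_derive_dx phiT t) cdx => y yb; rewrite /kink.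
    by rewrite ltW.
  by rewrite leNgt yb.
have mI : measurable (`]-N, N[%classic : set (measurableTypeR R)) by [].
have := has_integralD mI (has_integralZ (fluxE n a) mI (parts 1))
  (has_integralZ (fluxEm n a) mI (parts (2 * n + 1)%:R)).
rewrite !mulr0 addr0 => /(has_integral_mkcond _ _ _ mI).
apply: eq_has_integral => // x _; rewrite patchE /flux /E /Em.
case: ifPn => [_|xN]; first by rewrite !mulN1r mul1r.
have [-> ->] : phi (t, x) = 0 /\ dx phi t x = 0.
  apply: out; rewrite leNgt; apply/negP => xN'; move/negP: xN; apply.
  by rewrite inE /= in_itv /= -ltr_norml.
by rewrite !mulr0 subrr !mulr0 addr0.
Qed.

Lemma transport_out t x : 0 <= t < T -> T' <= t \/ M < `|x| -> transport t x = 0.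
Proof.
move=> tT tx; rewrite /transport dt_out // phi0 ?mulr0 ?addr0 //.
by case: tx => [|/ltW]; [left|right].
Qed.

Lemma measurable_strip : measurable (strip T : set plane).
Proof.
rewrite (_ : strip T = `[0, T[%classic `*` setT).
  by apply: measurableX => //; exact: measurable_itv.
by apply/seteqP; split => [z /= zT|z [/= + _]]; [split => //=|]; rewrite in_itv.
Qed.

Lemma integrable_strip (h g : R * R -> R) (C : R) :
  measurable_fun setT (h : plane -> R) -> (forall z, `|h z| <= C) ->
  continuous g ->
  (forall t x, 0 <= t < T -> T' <= t \/ M < `|x| -> g (t, x) = 0) ->
  (mu \x mu)%E.-integrable (strip T) (EFin \o (fun z => h z * g z)).
Proof.
move=> mh hC cg g0; have [K gK] := continuous_bounded_box T' M cg.
pose B : set plane := `[0, T']%classic `*` `[- M, M]%classic.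
have C0 : 0 <= C := le_trans (normr_ge0 _) (hC (0, 0)).
have K0 : 0 <= K.
  apply: le_trans (normr_ge0 _) (gK 0 0 _ _); rewrite ?normr0 ?lexx ltW //.
  by case/andP: T'T.
have tB t x : 0 <= t < T -> ~ B (t, x) -> T' <= t \/ M < `|x|.
  move=> tT ntx; have [|tT'] := leP T' t; first by left.
  right; rewrite ltNge; apply/negP => xM; apply: ntx; split => /=.
    by rewrite in_itv /= (ltW tT') andbT; case/andP: tT.
  by rewrite in_itv /= -ler_norml.
apply: (@integrable_bounded_support R _ plane (mu \x mu)%E _ B _ (C * K)).
- exact: measurable_strip.
- by apply: measurableX; exact: measurable_itv.
- have finI (u v : R) : (mu `[u, v]%classic < +oo)%E.
    exact: compact_finite_measure (@segment_compact _ _ _).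
  have prod_oo : (mu `[0%R, T']%classic * mu `[(- M)%R, M]%classic < +oo)%E.
    by rewrite lte_mul_pinfty // ge0_fin_numE.
  by apply: le_lt_trans prod_oo; rewrite -product_measure1E.
- apply: measurable_funTS; apply: measurable_funM => //.
  exact: continuous_measurable_plane.
- move=> [t x] tT; rewrite normrM; have [Bz|/(tB _ _ tT) out] := pselect (B (t, x)).
    move: Bz => [/=]; rewrite !in_itv /= => tT' xM.
    by apply: ler_pM => //; apply: gK => //; rewrite ler_norml.
  by rewrite g0 // normr0 mulr0 mulr_ge0.
- by move=> [t x] tT /(tB _ _ tT) out; rewrite g0 // mulr0.
Qed.

Lemma measurable_E : measurable_fun setT (fun z : plane => E z.1 z.2).
Proof.
by have := measurable_profile 1 c; apply: eq_measurable_fun => z _; rewrite mulN1r.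
Qed.

Lemma normr_E_le1 t x : `|E t x| <= 1.
Proof. exact: normr_profile_le1. Qed.

Lemma normr_Em_le1 t x : `|Em t x| <= 1.
Proof. by rewrite ger0_norm ?expR_ge0 // expR_le1 mulNr oppr_le0 mulr_ge0. Qed.

Lemma normr_comb_le (p q e f : R) : `|e| <= 1 -> `|f| <= 1 ->
  `|p * e + q * f| <= `|p| + `|q|.
Proof.
move=> e1 f1; apply: le_trans (ler_normD _ _) _.
by apply: lerD; rewrite normrM ler_piMr.
Qed.

(** In closed form the integrand is a sum of three products: a bounded measurable factor times
    phi_t, phi_x or phi. *)
Lemma integrable_weak_integrand : (mu \x mu)%E.-integrable (strip T)
  (fun z => (weak_integrand n (peakon a c) (peakon_slope a c) phi z.1 z.2)%:E).
Proof.
have mE := measurable_E.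
have mEm : measurable_fun setT (fun z : plane => Em z.1 z.2) :=
  measurable_profile _ c.
have mK := @measurable_kink R c.
have mS := measurable_strip.
have comb p q : measurable_fun setT
    (fun z : plane => p * E z.1 z.2 + q * Em z.1 z.2).
  exact: measurable_funD (measurable_funM (measurable_cst p) mE)
    (measurable_funM (measurable_cst q) mEm).
have i1 := @integrable_strip (fun z => a * E z.1 z.2) _ `|a|
  (measurable_funM (measurable_cst a) mE) _ (test_continuous_dt phiT) dt_out.
have i2 := @integrable_strip
  (fun z => fluxE n a * E z.1 z.2 + fluxEm n a * Em z.1 z.2) _
  (`|fluxE n a| + `|fluxEm n a|) (comb _ _) _ (test_continuous_dx phiT) dx_out.
have i3 := @integrable_strip
  (fun z => kink (c * z.1) z.2 * ((a * c - fluxE n a) * E z.1 z.2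
      + - ((2 * n + 1)%:R * fluxEm n a) * Em z.1 z.2)) _
  (`|a * c - fluxE n a| + `|- ((2 * n + 1)%:R * fluxEm n a)|)
  (measurable_funM mK (comb _ _)) _ (test_continuous phiT).
apply: eq_integrable (integrableD mS (integrableD mS (i1 _) (i2 _)) (i3 _ _)) => //.
- move=> z _ /=; rewrite -!EFinD; congr EFin; rewrite weak_integrand_peakon //.
  by rewrite -surjective_pairing [- (_ * fluxEm n a) * _]mulNr.
- by move=> z; rewrite normrM ler_piMr // normr_E_le1.
- by move=> z; apply: normr_comb_le; [exact: normr_E_le1|exact: normr_Em_le1].
- move=> z; rewrite normrM normr_kink mul1r.
  by apply: normr_comb_le; [exact: normr_E_le1|exact: normr_Em_le1].
- by move=> t x tT tx; apply: phi0 => //; case: tx => [|/ltW]; [left|right].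
Qed.

Lemma integrable_transport : (mu \x mu)%E.-integrable (strip T)
  (EFin \o (fun z => transport z.1 z.2)).
Proof.
have mE := measurable_E.
have mK := @measurable_kink R c.
have mS := measurable_strip.
have i1 := @integrable_strip (fun z => a * E z.1 z.2) _ `|a|
  (measurable_funM (measurable_cst a) mE) _ (test_continuous_dt phiT) dt_out.
have i2 := @integrable_strip (fun z => a * c * (kink (c * z.1) z.2 * E z.1 z.2)) _
  `|a * c| (measurable_funM (measurable_cst (a * c)) (measurable_funM mK mE)) _
  (test_continuous phiT).
apply: eq_integrable (integrableD mS (i1 _) (i2 _ _)) => //.
- by move=> z _ /=; rewrite -EFinD /transport -surjective_pairing.
- by move=> z; rewrite normrM ler_piMr // normr_E_le1.
- by move=> z; rewrite normrM ler_piMr // normrM normr_kink mul1r normr_E_le1.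
- by move=> t x tT tx; apply: phi0 => //; case: tx => [|/ltW]; [left|right].
Qed.

(** Joint integrability would give this for almost every t only; the inner integral is split at
    every t in [0, T). *)
Lemma integrable_transport_section t : 0 <= t < T ->
  mu.-integrable setT (EFin \o transport t).
Proof.
move=> tT.
have mE := measurable_profile1 (c * t).
have mK := measurable_kink_section (c * t).
have i1 := @integrable_mul_compact R (fun x => a * E t x) _ M `|a|
  (measurable_funM (measurable_cst a) mE) _
  (@continuous_section2 R _ t (test_continuous_dt phiT)).
have i2 := @integrable_mul_compact R (fun x => a * c * (kink (c * t) x * E t x)) _ M
  `|a * c| (measurable_funM (measurable_cst (a * c)) (measurable_funM mK mE)) _
  (@continuous_section2 R _ t (test_continuous phiT)).
apply: eq_integrable (integrableD measurableT (i1 _ _) (i2 _ _)) => //.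
- by move=> x; rewrite normrM ler_piMr // normr_E_le1.
- by move=> x Mx; apply: dt_out => //; right.
- by move=> x; rewrite normrM ler_piMr // normrM normr_kink mul1r normr_E_le1.
- by move=> x Mx; exact: phi_out.
Qed.

Lemma Rintegral_weak_integrand t : 0 <= t < T ->
  \int[mu]_x weak_integrand n (peakon a c) (peakon_slope a c) phi t x =
  \int[mu]_x transport t x.
Proof.
move=> tT; have [fi f0] := has_integral_flux tT.
under eq_Rintegral do rewrite weak_integrand_split.
by rewrite RintegralD // ?f0 ?addr0 //; exact: integrable_transport_section.
Qed.

(* For fixed x, t |-> e^{-|x - ct|} = e^{-c|t - x/c|} has the same kinked
   exponential shape in t as in x. *)
Lemma has_integral_transport_time x :
  has_integral mu `[0, T[ (fun t => transport t x)
    (- (a * expR (- `|x|) * phi (0, x))).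
Proof.
have /andP[T'0 T'T1] := T'T.
have cdt := @continuous_section1 R _ x (test_continuous_dt phiT).
have profileE t : - c * `|t - x / c| = - `|x - c * t|.
  rewrite mulNr -{1}(gtr0_norm c0) -normrM mulrBr mulrCA divff ?gt_eqF //.
  by rewrite mulr1 distrC.
(* The sign is reversed in time: once t > x / c the crest has passed x, which then lies to its
   left. *)
have := @has_integral_kinked_parts R c (x / c) 0 T' (fun t => - kink (c * t) x)
  (fun t => phi (t, x)) (fun t => dt phi t x) (ltW T'0).
have phiT' : phi (T', x) = 0 by apply: phi0; [rewrite ltW|left].
rewrite !profileE phiT' mulr0 sub0r mulr0 subr0 => h.
have {}h := h _ _ (fun t => is_derive_dt phiT t x) cdt.
have mI : measurable (`]0, T'[%classic : set (measurableTypeR R)) by [].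
have {}h : has_integral mu `]0, T'[ (fun t => transport t x)
    (- (a * expR (- `|x|) * phi (0, x))).
  rewrite -mulrA -mulrN.
  apply: eq_has_integral (has_integralZ a mI (h _ _)) => //.
  - by move=> t _; rewrite profileE /transport /E; ring.
  - by move=> t; rewrite ltr_pdivrMr // mulrC /kink => xt; rewrite leNgt xt opprK.
  - by move=> t; rewrite ltr_pdivlMr // mulrC /kink => /ltW ->.
(* The point 0 is null and [transport] vanishes on [T', T[, so the integral over ]0, T'[ is all that
   remains. *)
have -> : `[0, T[%classic = [set 0] `|` `]0, T'[ `|` `[T', T[ :> set R.
  apply/seteqP; split => t /=; rewrite !in_itv /=.
    move=> /andP[t0 tT]; have [T't|tT'] := leP T' t; first by right; rewrite tT.
    by left; move: t0; rewrite le_eqVlt => /predU1P[<-|->]; [left|right].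
  move=> [[->|/andP[t0 tT']]|/andP[T't ->]]; rewrite ?lexx ?andbT /=.
  - exact: lt_trans T'0 T'T1.
  - by rewrite (ltW t0) (lt_trans tT').
  - exact: le_trans (ltW T'0) T't.
rewrite -[- _]addr0 -[- _]add0r.
apply: has_integral_setU => //; first exact: measurableU.
- apply/seteqP; split => // t [/= + +]; rewrite !in_itv /=.
  move=> [->|/andP[_ tT']] /andP[T't _]; first by rewrite leNgt T'0 in T't.
  by rewrite leNgt tT' in T't.
- apply: has_integral_setU (has_integral_set1 0 _) h => //.
  apply/seteqP; split => // t [/= -> +]; by rewrite in_itv /= ltxx.
- apply: (@eq_has_integral _ _ _ _ _ (cst 0)) => //.
    move=> t /set_mem /=; rewrite in_itv /= => /andP[T't tT].
    by rewrite transport_out //; [rewrite tT (le_trans (ltW T'0) T't)|left].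
  split; first exact: integrable0.
  by rewrite Rintegral_cst ?mul0r.
Qed.

Lemma weak_form_peakon :
  \int[mu]_(t in `[0, T[)
    (\int[mu]_x weak_integrand n (peakon a c) (peakon_slope a c) phi t x)
  + \int[mu]_x (a * expR (- `|x|) * phi (0, x)) = 0.
Proof.
have T0 : 0 < T by case/andP: T'T; exact: lt_trans.
(* The flux drops out at each t, and [transport] is extended by zero outside the strip so that
   Fubini applies on the whole plane. *)
have -> : \int[mu]_(t in `[0, T[)
    (\int[mu]_x weak_integrand n (peakon a c) (peakon_slope a c) phi t x) =
    \int[mu]_t \int[mu]_x ((fun z => transport z.1 z.2) \_ (strip T)) (t, x).
  rewrite Rintegral_mkcond; apply: eq_Rintegral => t _; rewrite patchE.
  case: ifPn => [|tT].
    rewrite inE /= in_itv /= => tT; rewrite Rintegral_weak_integrand //.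
    by apply: eq_Rintegral => x _; rewrite patchE ifT // inE.
  transitivity (\int[mu]_x (cst 0 x : R)).
    by rewrite Rintegral_cst ?mul0r.
  apply: eq_Rintegral => x _; rewrite patchE ifF //; apply/negP.
  by rewrite inE => zT; move/negP: tT; apply; rewrite inE /= in_itv.
rewrite Fubini_Rintegral; last first.
  by have := (integrable_mkcond _ measurable_strip).1 integrable_transport;
    rewrite restrict_EFin.
have u0i : mu.-integrable setT (EFin \o (fun x => a * expR (- `|x|) * phi (0, x))).
  have mE : measurable_fun setT (fun x : R => expR (- `|x|)).
    have := measurable_profile1 (0 : R).
    by apply: eq_measurable_fun => x _; rewrite subr0.
  apply: (@integrable_mul_compact R _ _ M `|a|).
  - exact: measurable_funM.
  - by move=> x; rewrite normrM ler_piMr // normr_profile_le1.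
  - exact: (@continuous_section2 R _ 0 (test_continuous phiT)).
  - by move=> x Mx; apply: phi_out; rewrite ?lexx.
have -> : \int[mu]_x \int[mu]_t ((fun z => transport z.1 z.2) \_ (strip T)) (t, x) =
    \int[mu]_x (- 1 * (a * expR (- `|x|) * phi (0, x))).
  apply: eq_Rintegral => x _; have [_] := has_integral_transport_time x.
  rewrite mulN1r => <-; rewrite [RHS]Rintegral_mkcond; apply: eq_Rintegral => t _.
  by rewrite !patchE (_ : ((t, x) \in strip T) = (t \in `[0, T[%classic)).
by rewrite RintegralZl // mulN1r addNr.
Qed.

End WeakForm.

Theorem theorem2p1 (R : realType) (n : nat) (hn : (2 <= n)%N)
    (c : R) (hc : 0 < c) :
  (exists a : R, c = speed n a) /\
  forall a : R, c = speed n a ->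
    global_weak_solution n (fun x => a * expR (- `|x|)) (peakon a c).
Proof.
have n0 : (0 < n)%N by exact: ltn_trans hn.
split; first exact: exists_speed.
move=> a cE T T0; have p1 : 1 <= (2 * n + 1)%:R :> R by rewrite ler1n addn1.
split; first exact: W1_profile.
exists (peakon_slope a c); split.
- exact: Linfloc_W1loc_peakon.
- apply: aeW => z _; split.
    by have [] := has_integral_green_sourceA a c z.1 z.2 n0.
  by have [] := has_integral_green_sourceB a c z.1 z.2 n0.
- move=> phi phiT; have [T' [M [T'T M0 phi0]]] := test_support phiT T0.
  split; first exact: (integrable_weak_integrand n0 cE phiT T'T M0 phi0).
  exact: (weak_form_peakon n0 hc cE phiT T'T M0 phi0).
Qed.
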